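(* Let $p$ be a prime and let $G$ be a finite solvable group. Let $\chi \in \mathrm{Irr}(G)$ have degree not divisible by $p$, and let $P \in \mathrm{Syl}_p(G)$. If $\chi(1)$ is odd, then there exists $g \in \mathbf{N}_G(P)/P'$ such that $o(g)=f_\chi$. In particular, the Feit number $f_\chi$ divides $|\mathbf{N}_G(P) : P'|$.
   Context: $\mathrm{Irr}(G)$ is the set of irreducible complex characters of the finite group $G$. $\mathrm{Syl}_p(G)$ is the set of Sylow $p$-subgroups of $G$, $\mathbf{N}_G(P)$ is the normalizer of $P$ in $G$, and $P'$ is the derived (commutator) subgroup of $P$. $o(g)$ denotes the order of the element $g$ (here, of the quotient group $\mathbf{N}_G(P)/P'$). For a positive integer $n$, $\mathbb{Q}_n$ is the cyclotomic field obtained by adjoining a primitive $n$-th root of unity to $\mathbb{Q}$. For a character $\chi$ of $G$, $\mathbb{Q}(\chi)=\mathbb{Q}(\chi(x) \mid x\in G)$ is its field of values. The Feit number $f_\chi$ of $\chi$ is the smallest positive integer $n$ such that $\mathbb{Q}(\chi)\subseteq \mathbb{Q}_n$. *)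

(* Defs.v *)
From HB Require Import structures.
From mathcomp Require Import all_boot all_order all_algebra all_fingroup.
From mathcomp Require Import all_solvable all_field all_character.

Set Implicit Arguments.
Unset Strict Implicit.
Unset Printing Implicit Defensive.

Import Order.TTheory GRing.Theory Num.Theory.
Local Open Scope ring_scope.

(* x lies in every subfield of algC containing s. Quantifying over boolean    *)
(* predicates loses nothing: Q(s) is itself decidable, as shown below.        *)
Definition in_Q_adjoin (s : seq algC) (x : algC) : Prop :=
  forall S : {pred algC}, divring_closed S -> {subset s <= S} -> x \in S.

Lemma mem_num_field_adjoin (Qs : fieldExtType rat)
    (QsC : {rmorphism Qs -> algC}) (T : {pred algC}) (s : seq Qs) u :
  divring_closed T -> {in s, forall y, QsC y \in T} ->
  u \in <<1 & s>>%VS -> QsC u \in T.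
Proof.
move=> divT; pose B := GRing.isDivringClosed.Build algC T divT.
pose T' : divringClosed algC := HB.pack T B; rewrite -[T]/(T' : {pred _}).
elim/last_ind: s u => [|s y IHs] u Ts.
  rewrite adjoin_nil subfield_closed => /vlineP[a ->].
  by rewrite rmorphZ_num rmorph1 mulr1 rpred_Crat ?Crat_rat.
rewrite adjoin_rcons => /Fadjoin_polyP[q /polyOverP Kq ->].
rewrite -horner_map rpred_horner //; last by rewrite Ts ?mem_rcons ?mem_head.
apply/polyOverP=> j; rewrite coef_map /=; apply: IHs => // v sv.
by rewrite Ts // mem_rcons inE sv orbT.
Qed.

Fact Q_adjoin_subproof s x : decidable (in_Q_adjoin s x).
Proof.
have [Qs [QsC [[|x1 s1] // [Dx Ds] _]]] := num_field_exists (x :: s).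
pose U := <<1 & s1>>%AS; pose b := vbasis U.
pose S : {pred algC} := Crat_span (map QsC b).
have SP y : reflect (exists2 u, u \in U & y = QsC u) (y \in S).
  apply: (iffP (Crat_spanP _ _)) => [[a ->] | [u Uu ->]].
    exists (\sum_i a i *: b`_i).
      apply: memv_suml => i _; rewrite memvZ // vbasis_mem // mem_nth //.
      by rewrite -(size_map QsC).
    rewrite rmorph_sum /=; apply: eq_bigr => i _.
    by rewrite rmorphZ_num (nth_map 0) // -(size_map QsC).
  apply/Crat_spanP; rewrite (coord_vbasis Uu) rmorph_sum rpred_sum //= => i _.
  rewrite rmorphZ_num Crat_spanZ ?mem_Crat_span // -/b.
  by rewrite -tnth_nth -tnth_map mem_tnth.
have divS: divring_closed S.
  split=> [|_ _ /SP[u Uu ->] /SP[v Uv ->]|_ _ /SP[u Uu ->] /SP[v Uv ->]].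
  - by apply/SP; exists 1; rewrite ?mem1v ?rmorph1.
  - by apply/SP; exists (u - v); rewrite ?rpredB ?rmorphB.
  by apply/SP; exists (u / v); rewrite ?rpred_div ?fmorph_div.
apply: decP (x \in S) _; apply: (iffP (SP x)) => [[u Uu ->] T divT sT|Qx].
  apply: (mem_num_field_adjoin divT) Uu => y s1y.
  by rewrite sT // -Ds map_f.
apply/SP/Qx => // w; rewrite -Ds => /mapP[y s1y ->].
by apply/SP; exists y; rewrite ?seqv_sub_adjoin.
Qed.

Definition Q_adjoin (s : seq algC) : {pred algC} := Q_adjoin_subproof s.

Lemma Q_adjoinP s x : reflect (in_Q_adjoin s x) (x \in Q_adjoin s).
Proof. exact: sumboolP. Qed.

(* Since n.-1.+1 = n for n > 0, the root is n-primitive; Q_0 is junk, namely Q.*)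
Definition Q_cyclotomic (n : nat) : {pred algC} :=
  Q_adjoin [:: sval (C_prim_root_exists (ltn0Sn n.-1))].

Definition cf_field (gT : finGroupType) (G : {group gT}) (chi : 'CF(G)) :
  {pred algC} := Q_adjoin [seq chi x | x in G].

Definition is_feit_number (gT : finGroupType) (G : {group gT}) (chi : 'CF(G))
    (n : nat) : Prop :=
  [/\ (0 < n)%N, {subset cf_field chi <= Q_cyclotomic n}
    & forall m, (0 < m)%N -> {subset cf_field chi <= Q_cyclotomic m} ->
      (n <= m)%N].

Lemma Q_adjoin_divring_closed s : divring_closed (Q_adjoin s).
Proof.
split=> [|x y /Q_adjoinP Sx /Q_adjoinP Sy|x y /Q_adjoinP Sx /Q_adjoinP Sy].
- by apply/Q_adjoinP=> S [].
- by apply/Q_adjoinP=> S divS sS; case: (divS) => _ -> //; [apply: Sx | apply: Sy].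
by apply/Q_adjoinP=> S divS sS; case: (divS) => _ _ -> //; [apply: Sx | apply: Sy].
Qed.

Lemma sub_Q_adjoin s : {subset s <= Q_adjoin s}.
Proof. by move=> x sx; apply/Q_adjoinP=> S _; apply. Qed.

Lemma Q_adjoin_subset s t :
  reflect {subset Q_adjoin s <= Q_adjoin t} (all (mem (Q_adjoin t)) s).
Proof.
apply: (iffP allP) => [st x /Q_adjoinP|st x sx]; last exact/st/sub_Q_adjoin.
by apply=> //; apply: Q_adjoin_divring_closed.
Qed.

Fact feit_number_subproof (gT : finGroupType) (G : {group gT}) (i : Iirr G) :
  {n | is_feit_number 'chi_i n}.
Proof.
set vals := [seq 'chi_i x | x in G].
pose z n := sval (C_prim_root_exists (ltn0Sn n.-1)).
pose P n := (0 < n)%N && all (mem (Q_adjoin [:: z n])) vals.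
have exP: exists n, P n.
  exists #|G|; rewrite /P cardG_gt0; apply/allP=> _ /imageP[x Gx ->] /=.
  have prim_z: #|G|.-primitive_root (z #|G|).
    by have := svalP (C_prim_root_exists (ltn0Sn #|G|.-1)); rewrite {1}prednK.
  set S := Q_adjoin _.
  pose B := GRing.isDivringClosed.Build algC S (@Q_adjoin_divring_closed _).
  pose S' : divringClosed algC := HB.pack S B.
  have Sz: z #|G| \in S' by apply: sub_Q_adjoin; rewrite mem_head.
  rewrite -[_ \in _]/('chi_i x \in S').
  have [rG ->] := char_reprP (irr_char i).
  have [e [_ [enx1 _] [-> _] _]] := repr_rsim_diag rG Gx.
  apply: rpred_sum => j _.
  have [|k ->] := prim_rootP prim_z (x := e 0 j); last exact: rpredX.
  by have /dvdnP[q ->] := order_dvdG Gx; rewrite mulnC exprM enx1 expr1n.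
case: (ex_minnP exP) => n /andP[n_gt0 /Q_adjoin_subset sub_n] min_n.
exists n; split=> // m m_gt0 /Q_adjoin_subset sub_m.
by rewrite min_n // /P m_gt0.
Qed.

Definition feit_number (gT : finGroupType) (G : {group gT}) (i : Iirr G) : nat :=
  sval (feit_number_subproof i).

Lemma feit_numberP (gT : finGroupType) (G : {group gT}) (i : Iirr G) :
  is_feit_number 'chi_i (feit_number i).
Proof. exact: svalP. Qed.

(* Main.v *)
Require Import Defs.
From HB Require Import structures.
From mathcomp Require Import all_boot all_order all_algebra all_fingroup.
From mathcomp Require Import all_solvable all_field all_character.
From mathcomp Require Import ring zify.

Set Implicit Arguments.
Unset Strict Implicit.
Unset Printing Implicit Defensive.

Import Order.TTheory GRing.Theory Num.Theory.
Local Open Scope ring_scope.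

(** Write P' for the derived subgroup of P. The proof produces one x in N_G(P)
    such that, whenever x ^ k lies in P', every automorphism of algC fixing the
    k-th roots of unity fixes chi ([feit_witness]). Taking for k the order of
    the coset xP', Galois theory turns this into Q(chi) <= Q_k; since Q(chi)
    then lies in the cyclotomic field of level gcd(f_chi, k) too
    ([cfAut_fix_gcd]), f_chi divides k, and a power of xP' has order f_chi.

    The element x is found by induction on |G| ([feit_witness_exists]). A
    witness for a character psi of a subgroup H of index prime to p is a
    witness for chi as soon as every automorphism fixing psi fixes chi; this
    settles the case where chi is induced from psi, and witnesses lift from
    G / ker chi. So chi may be assumed faithful and primitive. By Clifford
    theory every normal abelian subgroup is then central. If G is abelian, it
    is cyclic and a generator will do. Otherwise solvability gives a normal
    subgroup L > Z(G) with L / Z(G) abelian; then Z(L) = Z(G), and chi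
    restricts to a multiple of a faithful irreducible character theta of L of
    degree d with d ^ 2 = |L : Z(L)|. As d divides chi(1), this index is odd
    and prime to p.

    It remains to find H < G with LH = G, H meeting L in Z(L), and an
    irreducible character of H of degree chi(1) / d whose fixing automorphisms
    all fix chi. Let rho afford theta. The operators M |-> rho(x) M rho(x), for
    x in L, commute, because the two commutator scalars cancel; a common
    eigenvector T can be scaled to an involution of trace 1 that inverts every
    rho(x) up to a scalar, its twist ([inverter_exists]). Such involutions form
    a single orbit under conjugation by rho(L) ([inverter_uniq], which uses
    that |L : Z(L)| is odd), so the stabilizer H in G of the twist of T is the
    complement wanted, by a Frattini argument.

    An element h of H has a matrix X(h) intertwining rho with its conjugate by
    h, unique up to a scalar, and X(h) commutes with T. As the eigenspaces of T
    have dimensions differing by 1, requiring X(h) to have equal determinants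
    on both of them fixes the scalar, and X becomes a representation of H,
    trivial on Z(L). On the group of pairs (lh, h) with l in L and h in H, the
    map (lh, h) |-> rho(l) X(h) extends rho, so Gallagher's theorem factors chi
    as chi(lh) = tr(rho(l) X(h)) xi(h) with xi irreducible on H
    ([stab_inverter_char]). An automorphism fixing xi fixes the central
    character of theta, hence theta; it replaces T by another H-stable
    involution, which is conjugate to T by an element of L centralizing H, and
    so leaves the trace of rho(l) X(h) unchanged ([weil_mx_aut]). *)

(** * Determinants on the eigenspaces of an involution *)

Section InvolutoryMatrix.

Variables (F : numFieldType) (n : nat).
Implicit Types (T X Y : 'M[F]_n.+1) (c : F).

Definition plus_proj T : 'M[F]_n.+1 := 2^-1 *: (1%:M + T).
Definition minus_proj T : 'M[F]_n.+1 := 2^-1 *: (1%:M - T).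

(** When T is an involution commuting with X, these are the determinants of the
    restrictions of X to the eigenspaces of T for 1 and -1; completing X by the
    identity on the other eigenspace avoids a change of basis. *)
Definition plus_det T X := \det (X *m plus_proj T + minus_proj T).
Definition minus_det T X := \det (plus_proj T + X *m minus_proj T).

Lemma plus_minus_proj T : plus_proj T + minus_proj T = 1%:M.
Proof.
rewrite -scalerDr addrACA subrr addr0 -mulr2n -scaler_nat scalerA.
by rewrite mulVf ?scale1r // pnatr_eq0.
Qed.

Lemma plus_minus_projM T :
  T *m T = 1%:M ->
  [/\ plus_proj T *m plus_proj T = plus_proj T,
      plus_proj T *m minus_proj T = 0,
      minus_proj T *m plus_proj T = 0
    & minus_proj T *m minus_proj T = minus_proj T].
Proof.
move=> TT.
have pm0: plus_proj T *m minus_proj T = 0.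
  rewrite -scalemxAl -scalemxAr mulmxDl mul1mx mulmxBr mulmx1 TT.
  by rewrite addrC addrA subrK subrr !scaler0.
have mp0: minus_proj T *m plus_proj T = 0.
  rewrite -scalemxAl -scalemxAr mulmxBl mul1mx mulmxDr mulmx1 TT.
  by rewrite [T + _]addrC subrr !scaler0.
split=> //.
  by rewrite -[RHS]mulmx1 -(plus_minus_proj T) mulmxDr pm0 addr0.
by rewrite -[RHS]mulmx1 -(plus_minus_proj T) mulmxDr mp0 add0r.
Qed.

Lemma comm_proj T X :
  X *m T = T *m X ->
  X *m plus_proj T = plus_proj T *m X /\ X *m minus_proj T = minus_proj T *m X.
Proof.
move=> cXT; rewrite -!scalemxAl -!scalemxAr mulmxDl mulmxDr mulmxBl mulmxBr.
by rewrite mul1mx mulmx1 cXT.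
Qed.

Lemma plus_detM T X Y : T *m T = 1%:M -> Y *m T = T *m Y ->
  plus_det T (X *m Y) = plus_det T X * plus_det T Y.
Proof.
move=> TT /comm_proj[cYp cYm]; have [pp pm mp mm] := plus_minus_projM TT.
rewrite /plus_det -det_mulmx; congr (\det _).
rewrite -mulmxA cYp mulmxDl !mulmxDr !mulmxA -(mulmxA X (plus_proj T) (plus_proj T)) pp.
by rewrite -(mulmxA X _ (minus_proj T)) pm mp mm mulmx0 mul0mx addr0 add0r.
Qed.

Lemma minus_detM T X Y : T *m T = 1%:M -> Y *m T = T *m Y ->
  minus_det T (X *m Y) = minus_det T X * minus_det T Y.
Proof.
move=> TT /comm_proj[cYp cYm]; have [pp pm mp mm] := plus_minus_projM TT.
rewrite /minus_det -det_mulmx; congr (\det _).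
rewrite -mulmxA cYm mulmxDl !mulmxDr !mulmxA -(mulmxA X (minus_proj T) (minus_proj T)) mm.
by rewrite -(mulmxA X _ (plus_proj T)) mp pm pp mulmx0 mul0mx addr0 add0r.
Qed.

Lemma plus_det1 T : plus_det T 1%:M = 1.
Proof. by rewrite /plus_det mul1mx plus_minus_proj det1. Qed.

Lemma minus_det1 T : minus_det T 1%:M = 1.
Proof. by rewrite /minus_det mul1mx plus_minus_proj det1. Qed.

(** A diagonalizable T with eigenvalues 1 and -1 has for trace the difference
    of the two multiplicities, so trace 1 gives the eigenvalue 1 exactly one
    more dimension than -1. This is what makes scalars detectable by the ratio
    of the two determinants. *)
Lemma plus_minus_det_scalar T c : T *m T = 1%:M -> \tr T = 1 ->
  plus_det T c%:M = c * minus_det T c%:M.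
Proof.
move=> TT trT.
have /diagonalizableP[P uP /diagonalizable_forPex[D /(simmxP uP)PT]]:
    exists2 rs : seq F, uniq rs & mxminpoly T %| \prod_(x <- rs) ('X - x%:P).
  exists [:: 1; -1]; first by rewrite /= inE -subr_eq0 opprK -mulr2n pnatr_eq0.
  apply: mxminpoly_min; rewrite !big_cons big_nil mulr1 rmorphM !rmorphB /=.
  rewrite !horner_mx_C horner_mx_X (raddfN scalar_mx) opprK -mulmxE.
  by rewrite mulmxBl !mulmxDr TT mulmx1 !mul1mx [T + _]addrC subrr.
have DT: T = invmx P *m diag_mx D *m P by rewrite -mulmxA -PT mulKmx.
have D2 i: D 0 i * D 0 i = 1.
  have: diag_mx D *m diag_mx D = 1%:M.
    by rewrite -[_ *m _](mulmxK uP) -!mulmxA (mulmxA (diag_mx D) P) -PT -!mulmxA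
      (mulmxA (diag_mx D) P) -PT -!mulmxA (mulmxA T T) TT mul1mx mulmxV.
  by rewrite mulmx_diag => /matrixP/(_ i i); rewrite !mxE eqxx.
pose A := [pred i | D 0 i == 1].
have Dval i: D 0 i = if A i then 1 else -1.
  case: ifP => [/eqP//|/negP A'i]; have /eqP := D2 i.
  by rewrite -expr2 sqrf_eq1 => /orP[//|/eqP].
have cardA: #|A| = #|predC A|.+1.
  have: \tr T = #|A|%:R - #|predC A|%:R.
    rewrite DT mxtrace_mulC mulmxA mulmxV // mul1mx mxtrace_diag.
    rewrite (bigID A) /= -sumr_const -mulNrn -sumr_const; congr (_ + _).
      by apply: eq_big => // i /eqP.
    by apply: eq_big => // i A'i; rewrite Dval ifN.
  by rewrite trT => /esym/eqP; rewrite subr_eq -mulrS eqr_nat => /eqP.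
have detE (a b : F) : \det (a *: plus_proj T + b *: minus_proj T)
     = a ^+ #|A| * b ^+ #|predC A|.
  have ->: a *: plus_proj T + b *: minus_proj T =
      invmx P *m diag_mx (\row_i (if A i then a else b)) *m P.
    have ->: diag_mx (\row_i (if A i then a else b)) =
      a *: (2^-1 *: (1%:M + diag_mx D)) + b *: (2^-1 *: (1%:M - diag_mx D)).
      apply/matrixP=> i j; rewrite !mxE; case: (i == j); last first.
        by rewrite !mulr0n subr0 addr0 !mulr0 addr0.
      rewrite !mulr1n Dval; case: ifP => _.
        by rewrite subrr !mulr0 addr0 -mulr2n mulVf ?mulr1 ?pnatr_eq0.
      by rewrite opprK subrr !mulr0 add0r -mulr2n mulVf ?mulr1 ?pnatr_eq0.
    rewrite !(mulmxDr, mulmxDl, mulmxBr, mulmxBl) -!scalemxAr -!scalemxAl.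
    rewrite !(mulmxDr, mulmxDl, mulmxN, mulNmx) mulmx1 mulVmx //.
    by rewrite -DT.
  rewrite !det_mulmx mulrC mulrA -det_mulmx mulmxV // det1 mul1r det_diag.
  rewrite (bigID A) /= -!prodr_const; congr (_ * _).
    by apply: eq_big => // i Ai; rewrite mxE Ai.
  by apply: eq_big => // i A'i; rewrite mxE ifN.
rewrite /plus_det /minus_det !mul_scalar_mx.
have := detE c 1; rewrite scale1r => ->; have := detE 1 c; rewrite scale1r => ->.
by rewrite cardA !expr1n mulr1 mul1r exprS.
Qed.

End InvolutoryMatrix.

Section InvolutoryMatrixConj.

Variables (F : numFieldType) (n : nat) (T X B : 'M[F]_n.+1).

Lemma conj_projs (uB : B \in unitmx) :
  plus_proj (invmx B *m T *m B) = invmx B *m plus_proj T *m B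
  /\ minus_proj (invmx B *m T *m B) = invmx B *m minus_proj T *m B.
Proof.
rewrite -!scalemxAr -!scalemxAl mulmxDr mulmxDl mulmxBr mulmxBl mulmx1.
by rewrite mulVmx.
Qed.

Lemma plus_minus_det_conj (uB : B \in unitmx) :
  plus_det (invmx B *m T *m B) (invmx B *m X *m B) = plus_det T X
  /\ minus_det (invmx B *m T *m B) (invmx B *m X *m B) = minus_det T X.
Proof.
have [pB mB] := conj_projs uB; rewrite /plus_det /minus_det pB mB.
have detB A : \det (invmx B *m A *m B) = \det A.
  by rewrite !det_mulmx mulrAC -det_mulmx mulVmx // det1 mul1r.
split; rewrite -[RHS]detB mulmxDr mulmxDl -!mulmxA (mulmxA B) mulmxV //;
  by rewrite mul1mx.
Qed.

End InvolutoryMatrixConj.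

Lemma plus_minus_det_map (F : numFieldType) n (u : {rmorphism F -> F})
    (T X : 'M[F]_n.+1) :
  plus_det (map_mx u T) (map_mx u X) = u (plus_det T X)
  /\ minus_det (map_mx u T) (map_mx u X) = u (minus_det T X).
Proof.
rewrite /plus_det /minus_det -!det_map_mx !map_mxD !map_mxM !map_mxZ.
by rewrite !map_mxD map_mxN map_mx1 fmorphV rmorph_nat.
Qed.

(** Irreducibility depends only on the set of matrices of a representation, so
    it can be carried from one group to another without a morphism. *)
Lemma mx_irr_of_image (gT hT : finGroupType) (G : {group gT}) (H : {group hT}) n
    (rG : mx_representation algC G n) (rH : mx_representation algC H n) :
  (forall y, y \in G -> exists2 x, x \in H & rG y = rH x) ->
  mx_irreducible rG -> mx_irreducible rH.
Proof.
move=> rGH /mx_irrP[n_gt0 irrG]; apply/mx_irrP; split=> // U modU nzU.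
apply: irrG nzU; apply/mxmoduleP=> y /rGH[x Hx ->].
by move/mxmoduleP: modU; apply.
Qed.

(** * Faithful representations of class two groups *)

Section HeisenbergRepresentation.

Variables (gT : finGroupType) (L : {group gT}) (n : nat).
Variable rho : mx_representation algC L n.+1.

Hypothesis absr : mx_absolutely_irreducible rho.
Hypothesis ffr : mx_faithful rho.
Hypothesis cl2 : abelian (L / 'Z(L)).
Hypothesis oddV : odd #|L : 'Z(L)|%g.

Local Notation Z := 'Z(L)%g.
Let nZL : L \subset 'N(Z)%g. Proof. exact: gFnorm. Qed.
Let sZL : Z \subset L. Proof. exact: center_sub. Qed.
Let inL z : z \in Z -> z \in L. Proof. exact: (subsetP sZL). Qed.
Let inZ x z : x \in L -> z \in Z -> commute z x.
Proof. by move=> Lx /centerP[_]; apply. Qed.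

(** The central character: on the center, [rho z] is scalar and any diagonal
    entry gives its value. *)
Definition central_val z : algC := rho z 0 0.

Lemma rho_schur A : {in L, forall x, A *m rho x = rho x *m A} -> exists a, A = a%:M.
Proof.
move=> cA; have /(mx_abs_irr_cent_scalar absr)/is_scalar_mxP[a ->] : centgmx rho A.
  by apply/centgmxP.
by exists a.
Qed.

Lemma rho_center z : z \in Z -> rho z = (central_val z)%:M.
Proof.
move=> Zz; have [|a Da] := @rho_schur (rho z).
  by move=> x Lx; rewrite -!repr_mxM ?(inL Zz) // (inZ Lx Zz).
by rewrite /central_val Da mxE eqxx.
Qed.

Lemma central_valM : {in Z &, {morph central_val : y z / (y * z)%g >-> y * z}}.
Proof.
move=> y z Zy Zz; have /= := repr_mxM rho (inL Zy) (inL Zz).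
rewrite (rho_center Zy) (rho_center Zz) -scalar_mxM => /matrixP/(_ 0 0).
by rewrite !mxE eqxx.
Qed.

Lemma central_val1 : central_val 1%g = 1.
Proof. by rewrite /central_val repr_mx1 mxE. Qed.

Lemma central_val_eq1 z : z \in Z -> central_val z = 1 -> z = 1%g.
Proof.
move=> Zz lz1; apply/set1gP; apply: (subsetP ffr); apply/rkerP.
by rewrite (inL Zz) rho_center ?lz1.
Qed.

Lemma commg_center x y : x \in L -> y \in L -> [~ x, y]%g \in Z.
Proof.
move=> Lx Ly; have: L^`(1)%g \subset Z by rewrite der1_min.
by move/subsetP; apply; apply: mem_commg.
Qed.

Lemma rhoJ x y : x \in L -> y \in L -> rho (x ^ y)%g = central_val [~ x, y]%g *: rho x.
Proof.
move=> Lx Ly; have Zc := commg_center Lx Ly.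
rewrite conjg_mulR repr_mxM ?(inL Zc) // (rho_center Zc).
by rewrite mul_mx_scalar.
Qed.

Lemma expg_index_center x : x \in L -> (x ^+ #|L : Z|%g \in Z)%g.
Proof.
move=> Lx; rewrite -card_quotient //; apply: coset_idr.
  by rewrite groupX // (subsetP nZL).
by rewrite morphX ?(subsetP nZL) // expg_cardG // mem_quotient.
Qed.

Lemma sqr_center x : x \in L -> (x ^+ 2 \in Z)%g -> x \in Z.
Proof.
move=> Lx Zx2; have:= expg_index_center Lx.
rewrite -(odd_double_half #|L : Z|%g) oddV add1n expgS -mul2n expgM => Zxm.
rewrite -(groupMr _ (x := (x ^+ 2) ^+ (#|L : Z|%g./2))%g) //.
by rewrite groupX.
Qed.

Lemma sqrt_mod_center y : y \in L -> exists2 w, w \in L & (y^-1 * w ^+ 2 \in Z)%g.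
Proof.
move=> Ly; exists (y ^+ (#|L : Z|%g./2.+1))%g; first exact: groupX.
have:= expg_index_center Ly; rewrite -{1}(odd_double_half #|L : Z|%g) oddV add1n.
by rewrite -expgM muln2 doubleS [(y ^+ _.+2)%g]expgS mulKg.
Qed.

Lemma commg_exp x y : x \in L -> y \in L -> ([~ x, y] ^+ #|L : Z|%g = 1)%g.
Proof.
move=> Lx Ly; have Zc := commg_center Lx Ly.
rewrite -commgX; last exact/commute_sym/(inZ Ly Zc).
by apply/eqP/commgP/commute_sym/inZ; rewrite ?expg_index_center.
Qed.

(** The twist of an involution sees central elements only through the square of
    the central character; on elements of odd order nothing is lost. *)
Lemma central_val_sqr_eq1 z :
  z \in Z -> (z ^+ #|L : Z|%g = 1)%g -> central_val z ^+ 2 = 1 -> z = 1%g.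
Proof.
move=> Zz zm1; rewrite expr2 -central_valM // => /central_val_eq1.
rewrite groupM // => /(_ isT).
rewrite -expg2 => z2; rewrite -zm1 -(odd_double_half #|L : Z|%g) oddV add1n expgS.
by rewrite -mul2n expgM z2 expg1n mulg1.
Qed.

Lemma rho_trace_center z : z \in Z -> \tr (rho z) = n.+1%:R * central_val z.
Proof. by move=> Zz; rewrite rho_center // mxtrace_scalar mulr_natl. Qed.

(** If x is not central, some y moves x by a nontrivial central commutator, and
    conjugation by y multiplies the trace at x by its value, which is not 1. *)
Lemma rho_trace0 x : x \in L -> x \notin Z -> \tr (rho x) = 0.
Proof.
move=> Lx; apply: contraNeq => trx; apply/centerP; split=> // y Ly.
apply/commgP/eqP/central_val_eq1; first exact: commg_center.
apply: (mulIf trx); rewrite mul1r -mxtraceZ -rhoJ //.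
rewrite conjgE repr_mxM ?groupM ?groupV // mxtrace_mulC.
by rewrite -repr_mxM ?groupM ?groupV // mulgK.
Qed.

Lemma rho_schur_average (M : 'M_n.+1) :
  \sum_(x in L) rho x *m M *m rho x^-1%g = (#|L|%:R * \tr M / n.+1%:R)%:M.
Proof.
have [y Ly|a Da] := @rho_schur (\sum_(x in L) rho x *m M *m rho x^-1%g).
  rewrite [in LHS](reindex_inj (mulgI y)) /= mulmx_suml mulmx_sumr.
  apply: eq_big => [x|x]; first by rewrite groupMl.
  rewrite groupMl // => Lx; rewrite invMg !repr_mxM ?groupV //.
  by rewrite -!mulmxA -(repr_mxM rho _ Ly) ?groupV // mulVg repr_mx1 mulmx1.
rewrite Da; congr _%:M; have := congr1 mxtrace Da.
rewrite mxtrace_scalar -[_ *+ n.+1]mulr_natr raddf_sum /= (eq_bigr (fun=> \tr M)).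
  rewrite sumr_const -[_ *+ #|L|]mulr_natl => ->.
  by rewrite mulfK // pnatr_eq0.
move=> x Lx; rewrite mxtrace_mulC mulmxA -repr_mxM ?groupV // mulVg repr_mx1.
by rewrite mul1mx.
Qed.

Lemma dim_sqr_index_center : (n.+1 ^ 2 = #|L : Z|%g)%N.
Proof.
have irr_theta : cfRepr rho \in irr L.
  by apply/irr_reprP; exists (Representation rho); rewrite //; apply/mx_abs_irrW.
have [i Di] := irrP irr_theta.
have Zth : ('Z('chi_i) = Z)%CF.
  by apply/cfcenter_fful_irr; rewrite -Di /cfaithful cfker_repr.
apply/eqP; rewrite -eqC_nat natrX -Zth -(irr1_abelian_bound (i := i)) ?Zth //.
by rewrite -Di cfRepr1.
Qed.

(** * Inverting involutions *)

Lemma rhoC x y : x \in L -> y \in L ->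
  rho x *m rho y = central_val [~ x, y]%g *: (rho y *m rho x).
Proof.
move=> Lx Ly; have Zc := commg_center Lx Ly.
rewrite -!repr_mxM // commgC (repr_mxM _ (groupM Ly Lx) (inL Zc)) /=.
by rewrite (rho_center Zc) mul_mx_scalar.
Qed.

Lemma central_valV z : z \in Z -> central_val z^-1%g * central_val z = 1.
Proof. by move=> Zz; rewrite -central_valM ?groupV // mulVg central_val1. Qed.

Lemma rhoVK x (A : 'M_n.+1) : x \in L -> rho x^-1%g *m (rho x *m A) = A.
Proof. by move=> Lx; rewrite mulmxA -repr_mxM ?groupV // mulVg repr_mx1 mul1mx. Qed.

Lemma rhoKV x (A : 'M_n.+1) : x \in L -> rho x *m (rho x^-1%g *m A) = A.
Proof. by move=> Lx; rewrite mulmxA -repr_mxM ?groupV // mulgV repr_mx1 mul1mx. Qed.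

Lemma rhoK x (A : 'M_n.+1) : x \in L -> A *m rho x *m rho x^-1%g = A.
Proof. by move=> Lx; rewrite -mulmxA -repr_mxM ?groupV // mulgV repr_mx1 mulmx1. Qed.

Lemma rhoKr x (A : 'M_n.+1) : x \in L -> A *m rho x^-1%g *m rho x = A.
Proof. by move=> Lx; rewrite -mulmxA -repr_mxM ?groupV // mulVg repr_mx1 mulmx1. Qed.

(** When [rho x *m T *m rho x] is a multiple of a matrix T of trace 1, this is
    the factor. *)
Definition twist T x : algC := \tr (rho x *m T *m rho x).

Definition inverter T :=
  [/\ T *m T = 1%:M, \tr T = 1
    & {in L, forall x, rho x *m T *m rho x = twist T x *: T}].

(** The operators M |-> rho(x) M rho(x) and M |-> rho(y) M rho(y) commute: the
    exchange of x and y on the left and on the right of M produces the scalars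
    of [y, x] and of its inverse. A commuting family has a common
    eigenvector. *)
Lemma eigen_inverter :
  exists2 T : 'M_n.+1, T != 0
    & forall x, x \in L -> exists c, rho x *m T *m rho x = c *: T.
Proof.
pose Phi x : 'M[algC]_(n.+1 * n.+1) := lin_mx (mulmxr (rho x) \o mulmx (rho x)).
have PhiE x A : mxvec A *m Phi x = mxvec (rho x *m A *m rho x) by rewrite mul_vec_lin.
have [//|_ _ /mapP[x Lx ->] /mapP[y Ly ->]|v nz_v /allP stab_v] :=
  @common_eigenvector algC (n.+1 * n.+1) [seq Phi x | x <- enum L].
  rewrite !mem_enum in Lx Ly; apply/row_matrixP=> i.
  rewrite 2!rowE !mulmxA -(vec_mxK (delta_mx 0 i)) !PhiE; congr (mxvec _).
  set A := vec_mx _; rewrite !mulmxA -[_ *m rho x *m rho y]mulmxA.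
  rewrite -[_ *m rho y *m rho x]mulmxA.
  by rewrite (rhoC Ly Lx) -!scalemxAl -!scalemxAr.
exists (vec_mx v) => [|x Lx]; first by rewrite vec_mx_eq0.
have /sub_rVP[c Dc]: stablemx v (Phi x) by apply/stab_v/map_f; rewrite mem_enum.
exists c; apply: (can_inj mxvecK); rewrite -PhiE vec_mxK Dc.
by rewrite linearZ /= vec_mxK.
Qed.

(** The row space of T is stable under [rho], which is irreducible. *)
Lemma eigen_inverter_unit (T : 'M_n.+1) : T != 0 ->
  (forall x, x \in L -> exists c, rho x *m T *m rho x = c *: T) -> T \in unitmx.
Proof.
move=> nzT eigT; rewrite -row_full_unit.
have /mx_irrP[_ irrT] := mx_abs_irrW absr; apply: irrT => //.
apply/mxmoduleP=> x Lx; have [c Dc] := eigT _ Lx.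
by rewrite -(rhoVK (T *m rho x) Lx) [rho x *m _]mulmxA Dc -scalemxAr scalemxAl submxMl.
Qed.

Lemma inverter_exists : exists T, inverter T.
Proof.
have [T0 nzT0 eigT0] := eigen_inverter.
have uT0 := eigen_inverter_unit nzT0 eigT0.
have [x Lx|a Da] := @rho_schur (T0 *m T0).
  have [c Dc] := eigT0 _ Lx; have LVx : x^-1%g \in L by rewrite groupV.
  have [c' Dc'] := eigT0 _ LVx.
  have E : rho x *m T0 = c *: (T0 *m rho x^-1%g).
    by rewrite scalemxAl -Dc rhoK.
  have E' : rho x^-1%g *m T0 = c' *: (T0 *m rho x).
    by rewrite scalemxAl -Dc' -mulmxA -!mulmxA -repr_mxM // mulVg repr_mx1 mulmx1.
  have cc' : c * c' = 1.
    have: rho x *m (rho x^-1%g *m T0 *m rho x^-1%g) *m rho x = T0.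
      by rewrite -!mulmxA rhoKV // -repr_mxM // mulVg repr_mx1 mulmx1.
    rewrite Dc' -scalemxAr -scalemxAl Dc scalerA mulrC => E1.
    have: (c * c' - 1) *: T0 == 0 by rewrite scalerBl E1 scale1r subrr.
    by rewrite scaler_eq0 (negbTE nzT0) orbF subr_eq0 => /eqP.
  by rewrite -mulmxA [RHS]mulmxA E -scalemxAl -mulmxA E' -scalemxAr scalerA cc' scale1r.
have nz_a : a != 0.
  apply: contraTneq uT0 => a0; apply/negP=> uT; move/eqP: nzT0; apply.
  by rewrite -[T0](mulmxK uT) Da a0 -scalemx1 scale0r mul0mx.
pose T1 := (sqrtC a)^-1 *: T0.
have T11 : T1 *m T1 = 1%:M.
  rewrite -scalemxAl -scalemxAr scalerA Da -invfM -expr2 sqrtCK.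
  by rewrite -scalemx1 scalerA mulVf ?scale1r.
have eigT1 x : x \in L -> exists c, rho x *m T1 *m rho x = c *: T1.
  move=> Lx; have [c Dc] := eigT0 _ Lx; exists c.
  by rewrite -scalemxAr -scalemxAl Dc !scalerA mulrC.
clearbody T1; have trT1 : \tr T1 ^+ 2 = 1.
  have nz_n : n.+1%:R != 0 :> algC by rewrite pnatr_eq0.
  (* Multiplying by T1 turns the conjugate of T1 by rho x into a multiple of
     rho (x^-2), whose trace vanishes unless x is central. *)
  have := congr1 (fun A => \tr (T1 *m A)) (rho_schur_average T1).
  rewrite /= mulmx_sumr raddf_sum /= mul_mx_scalar mxtraceZ.
  rewrite (bigID (mem Z)) /= [X in _ + X]big1 ?addr0 => [|x /andP[Lx Z'x]].
    rewrite (eq_bigr (fun=> n.+1%:R)) => [|z /andP[Lz Zz]].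
      rewrite sumr_const (eq_card (B := mem Z)) => [E|z]; last first.
        by rewrite unfold_in /= andb_idl // => /inL.
      have nz_Z : #|Z|%:R != 0 :> algC by rewrite pnatr_eq0 -lt0n cardG_gt0.
      apply: (mulfI nz_Z); apply: (mulfI nz_n); rewrite mulr1 [RHS]mulr_natr E.
      rewrite -(Lagrange sZL) -dim_sqr_index_center natrM natrX /=.
      by move: n.+1%:R nz_n #|Z|%:R => d nz_d z; field.
    rewrite (rho_center Zz) mul_scalar_mx -scalemxAl (rho_center (groupVr Zz)).
    by rewrite mul_mx_scalar scalerA mulrC central_valV // scale1r T11 mxtrace1.
  have [c Dc] := eigT1 x Lx.
  have -> : rho x *m T1 = c *: (T1 *m rho x^-1%g) by rewrite scalemxAl -Dc rhoK.
  rewrite -scalemxAl. rewrite -scalemxAr !mulmxA T11 mul1mx -repr_mxM ?groupV //.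
  rewrite mxtraceZ rho_trace0 ?mulr0 //; first by rewrite groupM ?groupV.
  by rewrite -invMg groupV -expg2; apply: contra Z'x; apply: sqr_center.
have: (\tr T1 == 1) || (\tr T1 == -1) by rewrite -sqrf_eq1 trT1.
have fin T : T *m T = 1%:M -> \tr T = 1 ->
    (forall x, x \in L -> exists c, rho x *m T *m rho x = c *: T) -> inverter T.
  move=> TT trT eigT; split=> // x Lx; have [c Dc] := eigT x Lx.
  by rewrite /twist Dc mxtraceZ trT mulr1.
case/orP=> /eqP tr1; first by exists T1; apply: fin.
exists (- T1); apply: fin; rewrite ?mulNmx ?mulmxN ?opprK //.
  by rewrite raddfN /= tr1 opprK.
by move=> x /eigT1[c Dc]; exists c; rewrite mulmxN mulNmx Dc scalerN.
Qed.

Lemma inverter_swapl T x : inverter T -> x \in L ->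
  rho x *m T = twist T x *: (T *m rho x^-1%g).
Proof. by case=> _ _ invT Lx; rewrite scalemxAl -invT // rhoK. Qed.

Lemma inverter_swapr T x : inverter T -> x \in L ->
  T *m rho x = twist T x *: (rho x^-1%g *m T).
Proof.
by case=> _ _ invT Lx; rewrite scalemxAr -invT // -!mulmxA rhoVK.
Qed.

Lemma twistM_center T x z : x \in L -> z \in Z ->
  twist T (x * z)%g = twist T x * central_val z ^+ 2.
Proof.
move=> Lx Zz; rewrite /twist repr_mxM ?(inL Zz) // (rho_center Zz).
by rewrite mul_mx_scalar -scalemxAr -!scalemxAl !mxtraceZ mulrA mulrC expr2.
Qed.

(** Every linear character of L arising in this way is a commutator character
    x |-> [x, y]. Since the matrices rho(y) span all matrices, Y has a nonzero
    trace against one of them; comparing that trace before and after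
    conjugation by rho(x) shows that Y rho(y)^-1 commutes with rho(x). *)
Lemma scal_comm_rho (Y : 'M_n.+1) nu : Y != 0 ->
    {in L, forall x, Y *m rho x = nu x *: (rho x *m Y)} ->
  exists2 y, y \in L & exists a, Y = a *: rho y.
Proof.
move=> nzY cY.
have [y Ly trY] : exists2 y, y \in L & \tr (Y *m rho y^-1%g) != 0.
  apply/exists_inP; apply: contraNT nzY; rewrite negb_exists_in => /forall_inP tr0.
  have tr0' A : \tr (Y *m A) = 0.
    have /mx_abs_irrP[_ [a Da]] := absr; rewrite (Da A) mulmx_sumr raddf_sum big1 //=.
    move=> x Lx; rewrite -scalemxAr mxtraceZ -[x]invgK.
    by have:= tr0 x^-1%g; rewrite groupV negbK => /(_ Lx)/eqP->; rewrite mulr0.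
  apply/eqP/matrixP=> i j; rewrite mxE -[RHS](tr0' (delta_mx j i)).
  rewrite /mxtrace (bigD1 i) //= big1 ?addr0 => [|k ki].
    rewrite mxE (bigD1 j) //= big1 ?addr0 => [|k kj]; rewrite mxE.
      by rewrite !eqxx mulr1.
    by rewrite (negbTE kj) mulr0.
  by rewrite mxE big1 // => l _; rewrite mxE (negbTE ki) andbF mulr0.
have LVy : y^-1%g \in L by rewrite groupV.
pose B := Y *m rho y^-1%g.
have cB x : x \in L -> B *m rho x = (nu x * central_val [~ y^-1, x]%g) *: (rho x *m B).
  move=> Lx; rewrite -mulmxA (rhoC LVy Lx) -scalemxAr mulmxA (cY _ Lx) -scalemxAl.
  by rewrite scalerA -mulmxA mulrC.
have [x Lx|a Da] := @rho_schur B.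
  rewrite cB //; suffices ->: nu x * central_val [~ y^-1, x]%g = 1 by rewrite scale1r.
  apply: (mulIf trY); rewrite mul1r -/B -mxtraceZ.
  by rewrite -(rhoVK (_ *: B) Lx) -scalemxAr -cB // mulmxA mxtrace_mulC rhoKV.
exists y => //; exists a.
by rewrite -mul_scalar_mx -Da /B rhoKr.
Qed.

Lemma conj_inverter T B g : inverter T -> B \in unitmx -> g \in 'N(L)%g ->
    {in L, forall x, rho x *m B = B *m rho (x ^ g)%g} ->
  inverter (B *m T *m invmx B)
  /\ {in L, forall x, twist (B *m T *m invmx B) x = twist T (x ^ g)%g}.
Proof.
move=> [TT trT invT] uB nLg cB.
have trB A : \tr (B *m A *m invmx B) = \tr A.
  by rewrite mxtrace_mulC mulmxA mulVmx // mul1mx.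
have E x : x \in L -> rho x *m (B *m T *m invmx B) *m rho x
    = B *m (rho (x ^ g)%g *m T *m rho (x ^ g)%g) *m invmx B.
  move=> Lx; rewrite !mulmxA -cB // -!mulmxA; congr (_ *m (_ *m (_ *m _))).
  by apply: (canLR (mulKmx uB)); rewrite mulmxA -cB // mulmxK.
have kapE : {in L, forall x, twist (B *m T *m invmx B) x = twist T (x ^ g)%g}.
  by move=> x Lx; rewrite /twist E // trB.
split=> //; split; rewrite ?trB //; last move=> x Lx.
  by rewrite -!mulmxA (mulmxA (invmx B)) mulVmx // mul1mx (mulmxA T) TT mul1mx mulmxV.
by rewrite kapE // E // invT ?memJ_norm // -scalemxAr -scalemxAl.
Qed.

Lemma conj_inverter_rho T w : inverter T -> w \in L ->
  inverter (rho w *m T *m rho w^-1%g)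
  /\ {in L, forall x, twist (rho w *m T *m rho w^-1%g) x = twist T (x ^ w)%g}.
Proof.
move=> invT Lw; rewrite repr_mxV //; apply: conj_inverter => //.
- exact: repr_mx_unit.
- exact: (subsetP (normG L)).
by move=> x Lx; rewrite -!repr_mxM ?groupJ // conjgC.
Qed.

(** The product T' T commutes with rho up to scalars, hence is a multiple of
    some rho(y). Conjugating T by rho(w) multiplies it by a multiple of
    rho(w ^ 2), so it suffices to extract a square root w of y modulo the
    center; the traces show that the remaining scalar is 1. *)
Lemma inverter_uniq T T' : inverter T -> inverter T' ->
  exists2 w, w \in L & T' = rho w *m T *m rho w^-1%g.
Proof.
move=> invT invT'; have [TT trT _] := invT; have [_ trT' _] := invT'.
have [| |y Ly [a Da]] := @scal_comm_rho (T' *m T) (fun x => twist T x * twist T' x^-1%g).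
- apply: contraTneq isT => T'T0; have := trT'.
  rewrite -[T']mulmx1 -TT mulmxA T'T0 mul0mx mxtrace0 => /esym/eqP.
  by rewrite oner_eq0.
- move=> x Lx; rewrite -mulmxA inverter_swapr // -scalemxAr [T' *m (_ *m _)]mulmxA.
  by rewrite (inverter_swapr invT') ?groupV // invgK -scalemxAl scalerA mulmxA.
have [w Lw Zw] := sqrt_mod_center Ly; exists w => //.
have [[_ trw _] _] := conj_inverter_rho invT Lw.
have /= Dy : rho (w ^+ 2)%g = central_val (y^-1 * w ^+ 2)%g *: rho y.
  rewrite -{1}[(w ^+ 2)%g](mulKVg y) repr_mxM ?(inL Zw) //.
  by rewrite (rho_center Zw) mul_mx_scalar.
have nz_central_val z : z \in Z -> central_val z != 0.
  move=> Zz; apply: contraTneq (oner_neq0 algC) => l0.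
  by rewrite -(central_valV Zz) l0 mulr0 eqxx.
have [b Db] : exists b, rho w *m T *m rho w^-1%g = b *: T'.
  have -> : rho w *m T *m rho w^-1%g = twist T w^-1%g *: (rho w *m rho w *m T).
    by rewrite -mulmxA inverter_swapr ?groupV // invgK -scalemxAr mulmxA.
  rewrite -repr_mxM // -expg2 Dy -scalemxAl.
  have T'E : T' = a *: (rho y *m T) by rewrite scalemxAl -Da -mulmxA TT mulmx1.
  have nz_a : a != 0.
    apply: contraTneq (oner_neq0 algC) => a0; move: trT'.
    by rewrite T'E a0 scale0r mxtrace0 => <-; rewrite eqxx.
  exists (twist T w^-1%g * central_val (y^-1 * w ^+ 2)%g * a^-1).
  by rewrite T'E !scalerA mulfVK.
by move: trw; rewrite Db mxtraceZ trT' mulr1 => ->; rewrite scale1r.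
Qed.

(** * The Weil representation of the stabilizer of an involution *)

Lemma twistV T x : inverter T -> x \in L -> twist T x * twist T x^-1%g = 1.
Proof.
move=> invT Lx; have [TT trT _] := invT.
have E : T *m rho x = (twist T x * twist T x^-1%g) *: (T *m rho x).
  rewrite {1}inverter_swapr // inverter_swapl ?groupV // invgK scalerA //.
have nz : T *m rho x != 0.
  apply: contraTneq (oner_neq0 algC) => Tx0.
  by rewrite -trT -[T](rhoK _ Lx) Tx0 mul0mx mxtrace0 eqxx.
have: (twist T x * twist T x^-1%g - 1) *: (T *m rho x) == 0.
  by rewrite scalerBl -E scale1r subrr.
by rewrite scaler_eq0 (negbTE nz) orbF subr_eq0 => /eqP.
Qed.

Lemma twist_neq0 T x : inverter T -> x \in L -> twist T x != 0.
Proof.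
move=> invT Lx; apply: contraTneq (oner_neq0 algC) => k0.
by rewrite -(twistV invT Lx) k0 mul0r eqxx.
Qed.

Lemma intertwiner_exists g : g \in 'N(L)%g ->
    {in L, forall x, \tr (rho (x ^ g)%g) = \tr (rho x)} ->
  exists2 B, B \in unitmx & {in L, forall x, rho x *m B = B *m rho (x ^ g)%g}.
Proof.
move=> nLg trJ.
have rgP : mx_repr L (fun x => rho (x ^ g)%g).
  split=> [|x y Lx Ly]; first by rewrite conj1g repr_mx1.
  by rewrite conjMg repr_mxM ?memJ_norm.
have /cfRepr_rsimP[B _ freeB cB] : cfRepr rho == cfRepr (MxRepresentation rgP).
  by apply/eqP/cfun_inP=> x Lx; rewrite !cfunE Lx /= trJ.
by exists B; rewrite ?row_free_unit // in freeB *.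
Qed.

(** The conjugate of T under g is again an inverting involution, so an element
    of L moves T to the same place; only twists need to be compared, since
    they do not involve the choice of an intertwining matrix. *)
Lemma inverter_frattini T g : inverter T -> g \in 'N(L)%g ->
    {in L, forall x, \tr (rho (x ^ g)%g) = \tr (rho x)} ->
  exists2 w, w \in L & {in L, forall x, twist T (x ^ (w^-1 * g))%g = twist T x}.
Proof.
move=> invT nLg trJ; have [B uB cB] := intertwiner_exists nLg trJ.
have [invT' kapT'] := conj_inverter invT uB nLg cB.
have [w Lw Dw] := inverter_uniq invT invT'; exists w => // x Lx.
have [_ kapw] := conj_inverter_rho invT Lw.
have LxV : (x ^ w^-1)%g \in L by rewrite groupJ ?groupV.
by rewrite conjgM -kapT' // Dw kapw // conjgKV.
Qed.

Lemma inverter_fix_center T w : inverter T -> w \in L ->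
  {in L, forall x, twist T (x ^ w)%g = twist T x} -> w \in Z.
Proof.
move=> invT Lw fixw; apply/centerP; split=> // x Lx; apply/commute_sym/commgP/eqP.
have Zc := commg_center Lx Lw; apply: central_val_sqr_eq1; rewrite ?commg_exp //.
apply: (mulfI (twist_neq0 invT Lx)); rewrite mulr1.
by rewrite -twistM_center // -conjg_mulR fixw.
Qed.

(** X is the matrix of h in the Weil representation attached to T; the equality
    of determinants selects one intertwining matrix among its multiples. *)
Definition weil_mx T h X :=
  [/\ X \in unitmx, {in L, forall x, rho x *m X = X *m rho (x ^ h)%g},
      X *m T = T *m X & plus_det T X = minus_det T X].

Lemma commT_det_neq0 (T X : 'M[algC]_n.+1) : 
    T *m T = 1%:M -> X \in unitmx -> X *m T = T *m X ->
  plus_det T X != 0 /\ minus_det T X != 0.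
Proof.
move=> TT uX cX; have cXV : invmx X *m T = T *m invmx X.
  by apply: (canLR (mulKmx uX)); rewrite mulmxA cX mulmxK.
split; apply: contraTneq (oner_neq0 algC) => d0.
  by rewrite -(plus_det1 T) -(mulmxV uX) plus_detM // d0 mul0r eqxx.
by rewrite -(minus_det1 T) -(mulmxV uX) minus_detM // d0 mul0r eqxx.
Qed.

(** Conjugating T by an intertwining matrix B gives an inverting involution
    with the same twist as T, hence a multiple of T, hence T by traces. So B
    commutes with T and only has to be rescaled. *)
Lemma weil_mx_exists T h : inverter T -> h \in 'N(L)%g ->
    {in L, forall x, \tr (rho (x ^ h)%g) = \tr (rho x)} ->
    {in L, forall x, twist T (x ^ h)%g = twist T x} ->
  exists X, weil_mx T h X.
Proof.
move=> invT nLh trJ fixh; have [B uB cB] := intertwiner_exists nLh trJ.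
have [invT' kapT'] := conj_inverter invT uB nLh cB.
set T' := _ *m invmx B in invT' kapT'.
have [TT trT _] := invT; have [_ trT' _] := invT'.
have [x Lx|a Da] := @rho_schur (T *m T').
  rewrite -mulmxA (inverter_swapr invT') // -scalemxAr [T *m (_ *m _)]mulmxA.
  rewrite (inverter_swapr invT) ?groupV // invgK -scalemxAl scalerA.
  by rewrite kapT' // fixh // twistV // scale1r mulmxA.
have T'T : T' = T.
  have T'a : T' = a *: T.
    by rewrite -[T']mul1mx -TT -mulmxA Da mul_mx_scalar.
  by move: trT'; rewrite T'a mxtraceZ trT mulr1 => ->; rewrite scale1r.
have cBT : B *m T = T *m B by rewrite -{2}T'T /T' mulmxKV.
have [nzp nzm] := commT_det_neq0 TT uB cBT.
pose c := minus_det T B / plus_det T B.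
have nzc : c != 0 by rewrite mulf_neq0 ?invr_eq0.
exists (c%:M *m B); split.
- by rewrite unitmx_mul uB andbT -scalemx1 unitmxZ ?unitmx1 ?unitfE.
- by move=> x Lx; rewrite mul_scalar_mx -scalemxAr -scalemxAl cB.
- by rewrite mul_scalar_mx -scalemxAr -scalemxAl cBT.
rewrite plus_detM // minus_detM // plus_minus_det_scalar //.
by rewrite mulrAC divfK // mulrC.
Qed.

Lemma weil_mx_uniq T h X X' : inverter T -> weil_mx T h X -> weil_mx T h X' -> X = X'.
Proof.
move=> [TT trT _] [uX iX cX dX] [uX' iX' cX' dX'].
have [x Lx|a Da] := @rho_schur (X *m invmx X').
  rewrite [RHS]mulmxA iX // -!mulmxA; congr (_ *m _).
  by apply: (canLR (mulKmx uX')); rewrite mulmxA -iX' // mulmxK.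
have XE : X = a%:M *m X' by rewrite -Da mulmxKV.
have [nzp nzm] := commT_det_neq0 TT uX' cX'.
have ca : a%:M *m T = T *m a%:M by rewrite scalar_mxC.
have ua : a%:M \in @unitmx algC n.+1 by rewrite -Da unitmx_mul uX unitmx_inv.
have [_ nza] := commT_det_neq0 TT ua ca.
move: dX; rewrite XE plus_detM // minus_detM // plus_minus_det_scalar // dX'.
move=> /(mulIf nzm)/esym/eqP; rewrite -subr_eq0 -{1}[minus_det _ _]mul1r -mulrBl.
rewrite mulf_eq0 (negbTE nza) orbF subr_eq0 => /eqP <-.
by rewrite mul1mx.
Qed.

Lemma weil_mxM T h h' X X' : inverter T -> h \in 'N(L)%g ->
  weil_mx T h X -> weil_mx T h' X' -> weil_mx T (h * h')%g (X *m X').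
Proof.
move=> [TT trT _] nLh [uX iX cX dX] [uX' iX' cX' dX']; split.
- by rewrite unitmx_mul uX.
- by move=> x Lx; rewrite mulmxA iX // -mulmxA iX' ?memJ_norm // -mulmxA conjgM.
- by rewrite -mulmxA cX' mulmxA cX mulmxA.
by rewrite plus_detM // minus_detM // dX dX'.
Qed.

Lemma weil_mx_cent T h : h \in 'C(L)%g -> weil_mx T h 1%:M.
Proof.
move=> cLh; split; rewrite ?unitmx1 ?plus_det1 ?minus_det1 ?mul1mx ?mulmx1 //.
by move=> x Lx; rewrite mul1mx mulmx1 /conjg -(centP cLh) // mulKg.
Qed.

(** The automorphism u maps rho to an equivalent representation, and T to an
    involution T' that inverts rho after a change of basis. Then T' is the
    conjugate of T by some rho(w), and h turns out to centralize w. So the Weil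
    matrix of h for T is also the one for T', which by uniqueness is the image
    of X under u. *)
Lemma weil_mx_aut (u : {rmorphism algC -> algC}) T h X :
    inverter T -> h \in 'N(L)%g -> h \in 'C(Z)%g ->
    {in L, forall x, twist T (x ^ h)%g = twist T x} ->
    {in Z, forall z, u (central_val z) = central_val z} -> weil_mx T h X ->
  {in L, forall x, u (\tr (rho x *m X)) = \tr (rho x *m X)}.
Proof.
move=> invT nLh cZh fixh fix_central_val wX; have [TT trT eT] := invT.
have /cfRepr_rsimP[B _ freeB cB] : cfRepr (map_repr u rho) == cfRepr rho.
  rewrite cfRepr_map; apply/eqP/cfun_inP=> x Lx; rewrite !cfunE Lx.
  have [Zx|Z'x] := boolP (x \in Z); last by rewrite rho_trace0 ?rmorph0.
  by rewrite rho_trace_center // rmorphM rmorph_nat fix_central_val.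
have uB : B \in unitmx by rewrite -row_free_unit.
have {}cB x : x \in L -> map_mx u (rho x) = B *m rho x *m invmx B.
  by move=> Lx; rewrite -cB // map_reprE mulmxK.
pose T' := invmx B *m map_mx u T *m B; pose X' := invmx B *m map_mx u X *m B.
have cB' x : x \in L -> rho x = invmx B *m map_mx u (rho x) *m B.
  by move=> Lx; rewrite cB // !mulmxA mulVmx // mul1mx mulmxKV.
have BK (M1 M2 : 'M_n.+1) :
    (invmx B *m M1 *m B) *m (invmx B *m M2 *m B) = invmx B *m (M1 *m M2) *m B.
  by rewrite !mulmxA mulmxK.
have trB (M : 'M_n.+1) : \tr (invmx B *m M *m B) = \tr M.
  by rewrite mxtrace_mulC mulmxA mulmxV // mul1mx.
have T'E x : x \in L -> rho x *m T' *m rho x = u (twist T x) *: T'.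
  move=> Lx; rewrite (cB' _ Lx) !BK -!map_mxM eT // map_mxZ.
  by rewrite -scalemxAr -scalemxAl.
have trT' : \tr T' = 1 by rewrite trB trace_map_mx trT rmorph1.
have kapT' x : x \in L -> twist T' x = u (twist T x).
  by move=> Lx; rewrite /twist T'E // mxtraceZ trT' mulr1.
have invT' : inverter T'.
  split=> //; last by move=> x Lx; rewrite T'E // kapT'.
  by rewrite BK -map_mxM TT map_mx1 mulmx1 mulVmx.
have [w Lw DT'] := inverter_uniq invT invT'.
have kapw x : x \in L -> twist T (x ^ w)%g = u (twist T x).
  by move=> Lx; rewrite -kapT' // DT'; have [_ ->] := conj_inverter_rho invT Lw.
have LJ x : x \in L -> (x ^ h)%g \in L by rewrite memJ_norm.
(* The twists of T and T' are both fixed by h, so w and w ^ h act alike on the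
   twist of T, and w moves by a central element z; comparing the twist of T at
   w and at w ^ h then shows that z is trivial. *)
have Zwh : (w^-1 * w ^ h)%g \in Z.
  apply: (inverter_fix_center invT); first by rewrite groupM ?groupV ?LJ.
  have kapwh x : x \in L -> twist T (x ^ (w ^ h))%g = u (twist T x).
    move=> Lx; rewrite -{1}[x](conjgKV h) -conjJg.
    have LhVx : (x ^ h^-1)%g \in L by rewrite memJ_norm ?groupV.
    by rewrite (fixh _ (groupJ LhVx Lw)) kapw // -fixh // conjgKV.
  move=> x Lx; have LxV : (x ^ w^-1)%g \in L by rewrite groupJ ?groupV.
  by rewrite conjgM kapwh // -kapw // conjgKV.
set z := (_ * _)%g in Zwh; have Dwh : (w ^ h = w * z)%g by rewrite mulKVg.
have z1 : z = 1%g.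
  apply: central_val_sqr_eq1 => //.
    apply: (mulgI (w ^+ #|L : Z|)%g); rewrite mulg1 -expgMn; last exact/commute_sym/inZ.
    by rewrite -Dwh -conjXg /conjg -(centP cZh _ (expg_index_center Lw)) mulKg.
  by apply: (mulfI (twist_neq0 invT Lw)); rewrite -twistM_center // -Dwh fixh // mulr1.
have {Dwh} Dwh : (w ^ h = w)%g by rewrite Dwh z1 mulg1.
have [uX iX cX dX] := wX.
have cwX : rho w *m X = X *m rho w by rewrite iX // Dwh.
have cwVX : rho w^-1%g *m X = X *m rho w^-1%g by rewrite iX ?groupV // conjVg Dwh.
have uR : rho w^-1%g \in unitmx by rewrite repr_mx_unit ?groupV.
have RV : invmx (rho w^-1%g) = rho w by rewrite -repr_mxV ?groupV // invgK.
have XR : X = invmx (rho w^-1%g) *m X *m rho w^-1%g by rewrite RV cwX rhoK.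
have T'R : T' = invmx (rho w^-1%g) *m T *m rho w^-1%g by rewrite RV.
have wX1 : weil_mx T' h X.
  split=> //.
    by rewrite DT' !mulmxA -cwX -!mulmxA cwVX (mulmxA X T) cX -mulmxA.
  by rewrite T'R XR; have [-> ->] := plus_minus_det_conj T X uR.
have wX2 : weil_mx T' h X'.
  split; first by rewrite !unitmx_mul unitmx_inv uB map_unitmx uX.
  - by move=> x Lx; rewrite (cB' _ Lx) (cB' _ (LJ _ Lx)) !BK -!map_mxM iX.
  - by rewrite !BK -!map_mxM cX.
  have [-> ->] := plus_minus_det_conj (map_mx u T) (map_mx u X) uB.
  by have [-> ->] := plus_minus_det_map u T X; rewrite dX.
have DX : X = X' := weil_mx_uniq invT' wX1 wX2.
move=> x Lx; rewrite -trace_map_mx map_mxM cB //.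
by rewrite [in RHS]DX /X' !mulmxA [RHS]mxtrace_mulC !mulmxA.
Qed.

(** * Transfer of characters to the complement *)

Section Complement.

Variables (G : {group gT}) (i : Iirr G) (e : algC).
Hypotheses (nsLG : (L <| G)%g) (cZG : G \subset 'C(Z)%g).
Hypothesis ResL : 'Res[L] 'chi_i = e *: cfRepr rho.

Let sLG : L \subset G. Proof. exact: normal_sub. Qed.
Let nLG g : g \in G -> g \in 'N(L)%g.
Proof. by move=> Gg; apply: (subsetP (normal_norm nsLG)). Qed.

Lemma rho_trace_inv g : g \in G -> {in L, forall x, \tr (rho (x ^ g)%g) = \tr (rho x)}.
Proof.
move=> Gg x Lx; have chiE y : y \in L -> 'chi_i y = e * \tr (rho y).
  by move=> Ly; rewrite -(cfResE _ sLG Ly) ResL !cfunE Ly.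
have nz_e : e != 0.
  apply: contraNneq (irr1_neq0 i) => e0.
  by rewrite chiE ?group1 // e0 mul0r.
apply: (mulfI nz_e); rewrite -!chiE ?memJ_norm ?nLG //.
by rewrite cfunJ.
Qed.

Variable T : 'M[algC]_n.+1.
Hypothesis invT : inverter T.

(** Stabilizing the twist rather than T itself makes sense before any matrix is
    attached to the elements of G. *)
Definition stab_inverter :=
  [set g in G | [forall x in L, twist T (x ^ g)%g == twist T x]].

Lemma stab_inverterP g :
  reflect (g \in G /\ {in L, forall x, twist T (x ^ g)%g = twist T x})
          (g \in stab_inverter).
Proof.
rewrite inE; apply: (iffP andP) => -[Gg /= fix_g]; split=> //.
  by move=> x Lx; apply/eqP; apply: (forall_inP fix_g).
by apply/forall_inP=> x Lx; rewrite fix_g.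
Qed.

Lemma stab_inverter_group_set : group_set stab_inverter.
Proof.
apply/group_setP; split; first by apply/stab_inverterP; split=> // x _; rewrite conjg1.
move=> g h /stab_inverterP[Gg fixg] /stab_inverterP[Gh fixh].
apply/stab_inverterP; split=> [|x Lx]; first exact: groupM.
by rewrite conjgM fixh ?fixg // memJ_norm ?nLG.
Qed.
Canonical stab_inverter_group := Group stab_inverter_group_set.

Local Notation H := stab_inverter.

Lemma stab_inverter_sub : H \subset G.
Proof. by apply/subsetP=> g /stab_inverterP[]. Qed.

(** Frattini argument for the action on inverting involutions, on which L is
    already transitive. *)
Lemma mulg_stab_inverter : (L * H = G)%g.
Proof.
apply/eqP; rewrite eqEsubset mul_subG ?stab_inverter_sub //=.
apply/subsetP=> g Gg.
have [w Lw fixw] := inverter_frattini invT (nLG Gg) (rho_trace_inv Gg).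
rewrite -[g](mulKVg w) mem_mulg //; apply/stab_inverterP; split=> //.
by rewrite groupM ?groupV // (subsetP sLG).
Qed.

Lemma stab_inverter_TI : L :&: H = Z.
Proof.
apply/setP=> x; rewrite inE; apply/andP/idP=> [[Lx /stab_inverterP[_ fixx]]|Zx].
  exact: inverter_fix_center invT Lx fixx.
split; first exact: inL.
apply/stab_inverterP; split=> [|y Ly]; first by rewrite (subsetP sLG) ?inL.
by rewrite /conjg -(inZ Ly Zx) mulKg.
Qed.

Lemma index_stab_inverter : #|G : H|%g = #|L : Z|%g.
Proof.
apply/eqP; rewrite -(eqn_pmul2l (cardG_gt0 H)) Lagrange ?stab_inverter_sub //.
rewrite -(eqn_pmul2l (cardG_gt0 Z)) mulnCA Lagrange //.
by rewrite (mulnC #|H|) (mul_cardG L stab_inverter_group) mulg_stab_inverter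
  stab_inverter_TI mulnC.
Qed.

Lemma stab_inverter_weil_mx h : exists X, h \in H -> weil_mx T h X.
Proof.
case Hh: (h \in H); last by exists 1%:M.
have [Gh fixh] := stab_inverterP _ Hh.
by have [X wX] := weil_mx_exists invT (nLG Gh) (rho_trace_inv Gh) fixh; exists X.
Qed.

(** The character of H is obtained from Gallagher's theorem in the group of
    pairs (lh, h): there rho extends to (lh, h) |-> rho(l) X(h), although it
    need not extend to G. *)
Lemma stab_inverter_char :
  exists k : Iirr stab_inverter_group,
    'chi_i 1%g = 'chi_k 1%g * n.+1%:R
    /\ forall u : {rmorphism algC -> algC},
         cfAut u 'chi_k = 'chi_k -> cfAut u 'chi_i = 'chi_i.
Proof.
have [Xf wX] := fin_all_exists stab_inverter_weil_mx.
have sHG := subsetP stab_inverter_sub.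
have Xf1 h : h \in H -> h \in 'C(L)%g -> Xf h = 1%:M.
  by move=> Hh cLh; apply: (weil_mx_uniq invT (wX _ Hh)); apply: weil_mx_cent.
have H1 : 1%g \in H := group1 stab_inverter_group.
(* The subgroup Gam of G x H is the semidirect product of L by H, mapping onto
   G by the first projection and onto H by the second. *)
pose Gam := [set a : gT * gT | (a.2 \in H) && (a.1 * a.2^-1 \in L)%g].
have GamE g h : ((g, h) \in Gam) = (h \in H) && (g * h^-1 \in L)%g by rewrite in_set.
have gGam : group_set Gam.
  apply/group_setP; split.
    by rewrite -[1%g]/((1, 1)%g : gT * gT) GamE invg1 mulg1 H1 group1.
  move=> [g h] [g' h']; rewrite (GamE g h) (GamE g' h') => /andP[Hh Lgh] /andP[Hh' Lgh'].
  rewrite -[(_ * _)%g]/((g * g', h * h')%g : gT * gT) GamE.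
  rewrite (groupM (G := stab_inverter_group)) //= invMg.
  have -> : (g * g' * (h'^-1 * h^-1) = (g * h^-1) * (g' * h'^-1) ^ h^-1)%g.
    by rewrite /conjg invgK !mulgA mulgKV.
  by rewrite groupM // memJ_norm // groupV nLG ?sHG.
pose Gm := Group gGam.
have GmP a : a \in Gm -> [/\ a.1 \in G, a.2 \in H & (a.1 * a.2^-1)%g \in L].
  case: a => g h; rewrite GamE => /andP[Ha La]; split=> //=.
  by rewrite -(mulgKV h g) groupM ?(subsetP sLG _ La) ?sHG.
pose R a := rho (a.1 * a.2^-1)%g *m Xf a.2.
have reprR : mx_repr Gm R.
  split=> [|[g h] [g' h'] /GmP[/= Gg Hh Lgh] /GmP[/= Gg' Hh' Lgh']].
    by rewrite /R -[1%g]/((1, 1)%g : gT * gT) /= invg1 mulg1 repr_mx1 mul1mx Xf1 //.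
  rewrite -[((g, h) * _)%g]/((g * g', h * h')%g : gT * gT) /R /=.
  have [uX iX cX dX] := wX _ Hh.
  have wXX := weil_mxM invT (nLG (sHG _ Hh)) (wX _ Hh) (wX _ Hh').
  have Hhh' : (h * h')%g \in H by apply: (groupM (G := stab_inverter_group)).
  rewrite (weil_mx_uniq invT (wX _ Hhh') wXX) invMg.
  have -> : (g * g' * (h'^-1 * h^-1) = (g * h^-1) * (g' * h'^-1) ^ h^-1)%g.
    by rewrite /conjg invgK !mulgA mulgKV.
  have LJ : ((g' * h'^-1) ^ h^-1)%g \in L.
    by rewrite memJ_norm // groupV nLG ?sHG.
  by rewrite repr_mxM // -!mulmxA; congr (_ *m _); rewrite !mulmxA iX // conjgKV.
pose rR := MxRepresentation reprR.
pose Nm := (setX_group L (1%G : {group gT})).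
have sNGm : Nm \subset Gm.
  apply/subsetP=> [[x y]] /setXP[/= Lx /set1P->].
  by rewrite GamE invg1 mulg1 Lx H1.
have nsNGm : (Nm <| Gm)%g.
  rewrite /normal sNGm; apply/subsetP=> -[g h] /GmP[/= Gg Hh Lgh].
  rewrite inE; apply/subsetP=> _ /imsetP[[x y] /setXP[/= Lx /set1P->] ->].
  rewrite -[((x, _) ^ _)%g]/((x ^ g, 1 ^ h)%g : gT * gT) in_setX /=.
  by rewrite memJ_norm ?nLG // Lx conj1g set11.
have R_L x : x \in L -> rR ((x, 1)%g : gT * gT) = rho x.
  by move=> Lx; rewrite /= /R /= invg1 mulg1 Xf1 ?group1 // mulmx1.
have irr_rho := mx_abs_irrW absr.
have irrR : mx_irreducible rR.
  apply: mx_irr_of_image irr_rho => x Lx.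
  exists ((x, 1)%g : gT * gT); last by rewrite R_L.
  by rewrite (subsetP sNGm) // in_setX /= Lx set11.
have irrRN : mx_irreducible (subg_repr rR sNGm).
  apply: mx_irr_of_image irr_rho => x Lx.
  exists ((x, 1)%g : gT * gT); last by rewrite -R_L.
  by rewrite in_setX /= Lx set11.
have [c Dc] : exists c, cfRepr rR = 'chi_c.
  by apply/irrP/irr_reprP; exists (Representation rR).
have [t Dt] : exists t, cfRepr (subg_repr rR sNGm) = 'chi_t.
  by apply/irrP/irr_reprP; exists (Representation (subg_repr rR sNGm)).
have cNt : 'Res[Nm] 'chi_c = 'chi_t by rewrite -Dc -Dt cfRepr_sub.
have [[d rS] /= irrS DS] := irr_reprP (mem_irr i).
have reprS : mx_repr Gm (fun a => rS a.1).
  split=> [|a b /GmP[Ga _ _] /GmP[Gb _ _]]; first exact: repr_mx1.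
  exact: repr_mxM.
(* chi pulled back to Gam along the first projection *)
pose rS' := MxRepresentation reprS.
have irrS' : mx_irreducible rS'.
  apply: mx_irr_of_image irrS => g; rewrite -{1}mulg_stab_inverter.
  case/mulsgP=> l h Ll Hh ->; exists ((l * h)%g, h) => //.
  by rewrite GamE Hh mulgK.
have [s Ds] : exists s, cfRepr rS' = 'chi_s.
  by apply/irrP/irr_reprP; exists (Representation rS').
have sE g h : (g, h) \in Gm -> 'chi_s (g, h) = 'chi_i g.
  by move=> Ggh; have [/= Gg _ _] := GmP _ Ggh; rewrite -Ds DS !cfunE Ggh Gg.
have ResN : 'Res[Nm] 'chi_s = e *: 'chi_t.
  apply/cfun_inP=> -[x y] Nxy; have /setXP[/= Lx /set1P Dy] := Nxy.
  rewrite cfResE // sE ?(subsetP sNGm) // -(cfResE _ sLG Lx) ResL -Dt !cfunE Nxy Lx.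
  by rewrite Dy -R_L.
have nz_e : e != 0.
  apply: contraNneq (irr1_neq0 i) => e0.
  by rewrite -(cfResE _ sLG (group1 L)) ResL e0 scale0r cfunE.
have [irrM _ conM _] := constt_Ind_ext nsNGm cNt.
have: s \in irr_constt ('Ind[Gm] 'chi_t).
  by rewrite constt_Ind_Res ResN irr_consttE cfdotZl cfdot_irr eqxx mulr1.
rewrite conM => /codomP[b Db].
have {Db} Db : 'chi_s = 'chi_(mod_Iirr b) * 'chi_c by rewrite Db cfIirrE.
have [[f rQ] /= irrQ DQ] := irr_reprP (mem_irr b).
(* Gam / N is isomorphic to H through the diagonal. *)
have diagG h : h \in H -> (h, h) \in Gm by move=> Hh; rewrite GamE Hh mulgV group1.
have nNdiag h : h \in H -> (h, h) \in 'N(Nm)%g.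
  by move=> Hh; rewrite (subsetP (normal_norm nsNGm)) ?diagG.
have reprQ : mx_repr stab_inverter_group (fun h => rQ (coset Nm (h, h))).
  split=> [|h h' Hh Hh']; first exact: etrans (congr1 rQ (morph1 _)) (repr_mx1 _).
  rewrite -[((h * h')%g, _)]/((h, h) * (h', h'))%g morphM ?nNdiag //.
  by rewrite repr_mxM ?mem_quotient ?diagG.
pose rQ' := MxRepresentation reprQ.
have cosetE g h : (g, h) \in Gm -> coset Nm (g, h) = coset Nm (h, h).
  move=> Ggh; have [/= Gg Hh Lgh] := GmP _ Ggh.
  have -> : (g, h) = ((g * h^-1, 1) * (h, h))%g.
    by rewrite -[(_ * _)%g]/(g * h^-1 * h, 1 * h)%g mulgKV mul1g.
  have Nx : ((g * h^-1)%g, 1%g) \in Nm by rewrite in_setX /= Lgh set11.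
  by rewrite morphM ?nNdiag ?(subsetP (normG Nm)) //= (coset_id Nx) mul1g.
have irrQ' : mx_irreducible rQ'.
  apply: mx_irr_of_image irrQ => _ /morphimP[[g h] _ Ggh ->].
  by have [_ /= Hh _] := GmP _ Ggh; exists h => //=; rewrite -(cosetE g).
have [k Dk] : exists k, cfRepr rQ' = 'chi_k.
  by apply/irrP/irr_reprP; exists (Representation rQ').
have chiE l h : l \in L -> h \in H ->
    'chi_i (l * h)%g = 'chi_k h * \tr (rho l *m Xf h).
  move=> Ll Hh; have Glh : ((l * h)%g, h) \in Gm by rewrite GamE Hh mulgK.
  rewrite -(sE _ _ Glh) Db cfunE mod_IirrE // cfModE // cosetE // DQ -Dk -Dc.
  by rewrite !cfunE mem_quotient ?diagG // Hh Glh /= /R /= mulgK.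
have chi_k1 : 'chi_i 1%g = 'chi_k 1%g * n.+1%:R.
  by rewrite -(mulg1 1%g) chiE ?group1 // mulg1 repr_mx1 mul1mx Xf1 ?group1 // mxtrace1.
exists k; split=> // u fix_k.
(* The factorizations of z as z * 1 and 1 * z in LH relate xi to the central
   character. *)
have fix_central_val : {in Z, forall z, u (central_val z) = central_val z}.
  have kz z : z \in Z -> 'chi_k z = 'chi_k 1%g * central_val z.
    move=> Zz; have Lz := inL Zz.
    have Hz : z \in H by move: (Zz); rewrite -stab_inverter_TI => /setIP[].
    have cLz : z \in 'C(L)%g by apply: (subsetP (subsetIr L _)).
    have := chiE _ _ Lz H1; have := chiE _ _ (group1 L) Hz.
    rewrite mulg1 mul1g repr_mx1 mul1mx (Xf1 _ Hz) // Xf1 ?group1 // mulmx1 => ->.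
    rewrite mxtrace1 rho_trace_center // mulrA => E.
    have nz_n : n.+1%:R != 0 :> algC by rewrite pnatr_eq0.
    by apply: (mulIf nz_n); rewrite E mulrAC.
  move=> z Zz; apply: (mulfI (irr1_neq0 k)); rewrite -kz //.
  have := congr1 (fun phi : 'CF(_) => phi z) fix_k.
  rewrite /= cfunE /= kz // rmorphM /= => <-; congr (_ * _).
  by rewrite aut_natr ?Cnat_irr1.
apply/cfun_inP=> g; rewrite -{1}mulg_stab_inverter => /mulsgP[l h Ll Hh ->].
have [Gh fixh] := stab_inverterP _ Hh.
rewrite cfunE chiE // rmorphM /=; congr (_ * _).
  by rewrite -{2}fix_k cfunE.
by apply: (weil_mx_aut invT (nLG Gh)) (wX _ Hh) _ Ll; rewrite ?(subsetP cZG).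
Qed.

End Complement.

End HeisenbergRepresentation.

(** * Reduction to primitive characters *)

Section FeitWitness.

Variable gT : finGroupType.
Implicit Types (G H P Q : {group gT}) (x : gT) (p : nat).

(** Up to the passage from automorphisms to fields, this says that chi has its
    values in the cyclotomic field whose level is the order of the coset of x
    modulo P'. Speaking of the powers of x that lie in P' instead of a quotient
    group makes transfers between groups immediate. *)
Definition feit_witness G P (chi : 'CF(G)) x :=
  x \in 'N_G(P)%g /\
  forall k, (x ^+ k \in P^`(1))%g ->
  forall u : {rmorphism algC -> algC},
    (forall z, z ^+ k = 1 -> u z = z) -> cfAut u chi = chi.

Lemma feit_witness_conj G P (chi : 'CF(G)) x g :
  g \in G -> feit_witness P chi x -> feit_witness (P :^ g) chi (x ^ g)%g.
Proof.
move=> Gg [/setIP[Gx nPx] fix_chi]; split=> [|k].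
  by rewrite inE groupJ //= normJ memJ_conjg.
by rewrite -conjXg derJ memJ_conjg => /fix_chi.
Qed.

(** A Sylow p-subgroup of H is one of G, hence a conjugate of P, and its
    normalizer in H is contained in its normalizer in G. *)
Lemma feit_witness_sub p G H P (chi : 'CF(G)) (psi : 'CF(H)) :
    prime p -> H \subset G -> ~~ (p %| #|G : H|%g)%N -> (p.-Sylow(G) P)%g ->
    (forall u : {rmorphism algC -> algC}, cfAut u psi = psi -> cfAut u chi = chi) ->
    (forall Q, (p.-Sylow(H) Q)%g -> exists x, feit_witness Q psi x) ->
  exists x, feit_witness P chi x.
Proof.
move=> pr_p sHG p'GH sylP fix_chi wit_psi.
have [Q sylQ] := Sylow_exists p H; have [x [/setIP[Hx nQx] fix_psi]] := wit_psi Q sylQ.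
have sylQG : (p.-Sylow(G) Q)%g.
  rewrite pHallE (subset_trans (pHall_sub sylQ)) //= (card_Hall sylQ).
  rewrite -(Lagrange sHG) partnM // (part_p'nat (n := #|G : H|%g)) ?muln1 //.
  by rewrite p'natE.
have [g Gg DP] := Sylow_trans sylQG sylP.
have -> : P = (Q :^ g)%G by apply: group_inj.
exists (x ^ g)%g; apply: feit_witness_conj => //; split.
  by rewrite inE (subsetP sHG).
by move=> k /fix_psi fixk u /fixk/fix_chi.
Qed.

End FeitWitness.

(** By the Frattini argument in KP, an element of G normalizing PK / K is
    congruent modulo K to one normalizing P. *)
Lemma feit_witness_mod (gT : finGroupType) (G P K : {group gT}) (p : nat)
    (chi : 'CF(G)) :
    (K <| G)%g -> K \subset cfker chi -> (p.-Sylow(G) P)%g ->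
    (exists y, feit_witness (P / K)%G (chi / K)%CF y) ->
  exists x, feit_witness P chi x.
Proof.
move=> nsKG kerK sylP [y [/setIP[Gy nPy] fix_y]].
have [sKG nKG] := andP nsKG; have sPG := pHall_sub sylP.
have nKP := subset_trans sPG nKG.
pose N := 'N_G(K <*> P)%G.
have nsKKP : (K <| K <*> P)%g by rewrite /normal joing_subl join_subG normG.
have nsKPN : (K <*> P <| N)%g.
  by rewrite /normal subsetI join_subG sKG sPG normG subsetIr.
have: y \in (N / K)%g.
  by rewrite quotient_subnormG // quotientYidl // inE Gy.
case/morphimP=> x0 nKx0 Nx0 Dy.
have sylPKP : (p.-Sylow(K <*> P) P)%g.
  by apply: pHall_subl sylP; rewrite ?joing_subr // join_subG sKG.
move: Nx0; rewrite -(Frattini_arg nsKPN sylPKP) /= norm_joinEr //.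
case/mulsgP=> _ n /mulsgP[k a Kk Pa ->].
case/setIP=> /setIP[Gn _] nPn Dx0.
have nKan : (a * n)%g \in 'N(K)%g.
  by rewrite groupM ?(subsetP nKP _ Pa) ?(subsetP nKG).
have Dy' : y = coset K (a * n)%g.
  by rewrite Dy Dx0 /= -mulgA (coset_kerl _ Kk).
exists (a * n)%g; split.
  have Na : a \in 'N_G(P)%g.
    by apply/setIP; split; [apply: (subsetP sPG) | apply: (subsetP (normG P))].
  by apply: groupM => //; apply/setIP.
move=> m Pan u fix_u; rewrite -(cfQuoK nsKG kerK) cfAutMod; congr (_ %% K)%CF.
apply: fix_y fix_u; rewrite Dy' -morphX //.
by rewrite -quotient_der // mem_quotient.
Qed.

Section Primitive.

Variables (gT : finGroupType) (G : {group gT}) (i : Iirr G).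
Hypothesis prim : forall (H : {group gT}) (k : Iirr H),
  H \proper G -> 'Ind[G] 'chi_k != 'chi_i.

(** Otherwise the inertia group of a constituent would be proper, and the
    Clifford correspondence would induce chi from it. *)
Lemma primitive_Res (N : {group gT}) j :
    (N <| G)%g -> j \in irr_constt ('Res[N] 'chi_i) ->
  exists e, 'Res[N] 'chi_i = e *: 'chi_j.
Proof.
move=> nsNG Nj; have [_ _ AtoB _ _] := constt_Inertia_bijection j nsNG.
have /imsetP[s Ts Di] : i \in Ind_Iirr G @: irr_constt ('Ind['I_G['chi_j]%G] 'chi_j).
  by rewrite AtoB constt_Ind_Res.
have [irrB _ _ _ _] := constt_Inertia_bijection j nsNG.
have {}Di : 'Ind[G] 'chi_s = 'chi_i by rewrite Di cfIirrE // irrB.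
have IG : G \subset 'I['chi_j]%g.
  apply: contraLR isT => not_IG; have := prim s _; rewrite Di eqxx => -> //.
  by rewrite properEneq Inertia_sub andbT; apply: contraNneq not_IG => /setIidPl.
exists '['Res[N] 'chi_i, 'chi_j].
by rewrite {1}(Clifford_Res_sum_cfclass nsNG Nj) cfclass_invariant // big_seq1.
Qed.

Hypothesis fful : cfaithful 'chi_i.

(** On A, chi is a multiple of a linear character, so the elements of A are
    represented by scalars. *)
Lemma primitive_abelian_center (A : {group gT}) :
  (A <| G)%g -> abelian A -> A \subset 'Z(G)%g.
Proof.
move=> nsAG abA; have sAG := normal_sub nsAG.
have nz : 'Res[A] 'chi_i != 0.
  by rewrite cfRes_eq0 ?irr_char ?irr_neq0.
have [j Aj] := neq0_has_constt nz.
have [e De] := primitive_Res nsAG Aj.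
have lin_j : 'chi_j \is a linear_char by apply/char_abelianP.
rewrite -(cfcenter_fful_irr fful); apply/subsetP=> a Aa.
rewrite /cfcenter irr_char inE (subsetP sAG) //=; apply/eqP.
have chiE y : y \in A -> 'chi_i y = e * 'chi_j y.
  by move=> Ay; rewrite -(cfResE _ sAG Ay) De cfunE.
rewrite !chiE ?group1 // normrM normC_lin_char // mulr1 (lin_char1 lin_j) mulr1.
by rewrite ger0_norm // -[e]mulr1 -(lin_char1 lin_j) -chiE ?group1 // char1_ge0 ?irr_char.
Qed.

End Primitive.

(** L is the preimage of a minimal normal subgroup of G / Z(G). It cannot be
    abelian, as it would be central, and its center is Z(G) for the same
    reason. *)
Lemma primitive_reduction (gT : finGroupType) (G : {group gT}) (i : Iirr G) :
    solvable G -> ~~ abelian G -> cfaithful 'chi_i ->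
    (forall (H : {group gT}) (k : Iirr H), H \proper G -> 'Ind[G] 'chi_k != 'chi_i) ->
    (forall d, 'chi_i 1%g = d%:R -> odd d) ->
  exists H : {group gT}, exists k : Iirr H, exists n : nat,
    [/\ H \proper G, #|G : H|%g = (n ^ 2)%N, 'chi_i 1%g = 'chi_k 1%g * n%:R
      & forall u : {rmorphism algC -> algC},
          cfAut u 'chi_k = 'chi_k -> cfAut u 'chi_i = 'chi_i].
Proof.
move=> solG nabG fful prim odd_chi.
have nsZG : ('Z(G) <| G)%g := center_normal G.
have ntGZ : (G / 'Z(G))%g != 1%g.
  rewrite -subG1 quotient_sub1 ?normal_norm //; apply: contra nabG => sGZ.
  exact: abelianS sGZ (center_abelian G).
have [M minM sMG] := minnormal_exists ntGZ (normG _).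
have solM := solvableS sMG (quotient_sol _ solG).
have [nMG ntM abM] := minnormal_solvable minM (subxx _) solM.
have nsMG : (M <| G / 'Z(G))%g by rewrite /normal sMG.
have [L DM sZL nsLG] := inv_quotientN nsZG nsMG.
have sLG := normal_sub nsLG.
have abLZ : abelian (L / 'Z(G))%g by rewrite -DM (abelem_abelian abM).
have ZL : 'Z(L)%g = 'Z(G)%g.
  apply/eqP; rewrite eqEsubset; apply/andP; split.
    apply: (primitive_abelian_center prim fful (A := 'Z(L)%G)) (center_abelian L).
    exact: char_normal_trans (center_char L) nsLG.
  rewrite subsetI sZL (subset_trans (subsetIr G _)) // centS //.
have [j Lj] : exists j, j \in irr_constt ('Res[L] 'chi_i).
  by apply: neq0_has_constt; rewrite cfRes_eq0 ?irr_char ?irr_neq0.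
have [e De] := primitive_Res prim nsLG Lj.
have [[[|n] rho] /= irr_rho Dj] := irr_reprP (mem_irr j).
  by have /mx_irrP[] := irr_rho.
have absr : mx_absolutely_irreducible rho by apply: groupC irr_rho.
have ResE : 'Res[L] 'chi_i = e *: cfRepr rho by rewrite De Dj.
have ffr : mx_faithful rho.
  apply/subsetP=> x /rkerP[Lx rx1]; apply: (subsetP fful).
  rewrite cfkerEirr inE -!(cfResE _ sLG) ?group1 // ResE !cfunE Lx group1 rx1.
  by rewrite repr_mx1.
have cl2 : abelian (L / 'Z(L))%g by rewrite ZL.
have dimE := dim_sqr_index_center absr ffr cl2.
have [m Dm] := dvdn_constt_Res1_irr1 nsLG Lj.
have odd_n : odd n.+1.
  have: odd (m * n.+1).
    by apply: odd_chi; rewrite Dm Dj cfRepr1 natrM.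
  by rewrite oddM => /andP[].
have oddV : odd #|L : 'Z(L)|%g by rewrite -dimE oddX odd_n orbT.
have cZG : G \subset 'C('Z(L))%g by rewrite ZL centsC subsetIr.
have [T invT] := inverter_exists absr ffr cl2 oddV.
have [k [chi1 fix_k]] := stab_inverter_char absr ffr cl2 oddV nsLG cZG ResE invT.
have iGH := index_stab_inverter absr ffr cl2 oddV nsLG ResE invT.
exists (stab_inverter_group rho nsLG T), k, n.+1; split=> //; last by rewrite iGH dimE.
rewrite properEneq stab_inverter_sub andbT; apply: contraNneq ntM => HG.
have nZL : L \subset 'N('Z(G))%g := subset_trans sLG (normal_norm nsZG).
rewrite DM -subG1 quotient_sub1 // -indexg_eq1.
by move: iGH; rewrite HG indexgg ZL => <-.
Qed.

Theorem feit_witness_exists p (gT : finGroupType) (G P : {group gT}) (i : Iirr G) :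
    prime p -> solvable G -> (p.-Sylow(G) P)%g ->
    (forall d, 'chi_i 1%g = d%:R -> ~~ (p %| d)%N) ->
    (forall d, 'chi_i 1%g = d%:R -> odd d) ->
  exists x, feit_witness P 'chi_i x.
Proof.
move=> pr_p; have [m leGm] := ubnP #|G|.
elim: m => // m IHm in gT G P i leGm *; move=> solG sylP p'chi odd_chi.
have reduce (H : {group gT}) (k : Iirr H) :
    H \proper G -> ~~ (p %| #|G : H|%g)%N ->
    (exists n, 'chi_i 1%g = 'chi_k 1%g * n%:R) ->
    (forall u : {rmorphism algC -> algC},
      cfAut u 'chi_k = 'chi_k -> cfAut u 'chi_i = 'chi_i) ->
  exists x, feit_witness P 'chi_i x.
  move=> prHG p'GH [n Dn] fix_k.
  have sHG := proper_sub prHG.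
  apply: (feit_witness_sub pr_p sHG p'GH sylP fix_k) => Q sylQ.
  apply: IHm sylQ _ _ => //.
  - by rewrite (leq_trans (proper_card prHG)).
  - exact: solvableS sHG solG.
  - move=> d Dd; have := p'chi (d * n)%N; rewrite Dn Dd natrM => /(_ erefl).
    by rewrite Euclid_dvdM // negb_or => /andP[].
  move=> d Dd; have := odd_chi (d * n)%N; rewrite Dn Dd natrM => /(_ erefl).
  by rewrite oddM => /andP[].
have [/existsP[H /andP[prHG /existsP[k /eqP Di]]] | not_ind] :=
    boolP [exists H : {group gT},
      (H \proper G) && [exists k : Iirr H, 'Ind[G] 'chi_k == 'chi_i]].
  have sHG := proper_sub prHG.
  have chi1 : 'chi_i 1%g = 'chi_k 1%g * #|G : H|%g%:R by rewrite -Di cfInd1 // mulrC.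
  have [d Dd] := natrP (Cnat_irr1 k).
  apply: (reduce H k) => //; last by move=> u fix_k; rewrite -Di cfAutInd fix_k.
    have := p'chi (d * #|G : H|%g)%N; rewrite chi1 Dd natrM => /(_ erefl).
    by rewrite Euclid_dvdM // negb_or => /andP[].
  by exists #|G : H|%g.
have prim (H : {group gT}) (k : Iirr H) : H \proper G -> 'Ind[G] 'chi_k != 'chi_i.
  move=> prHG; apply: contra not_ind => Di; apply/existsP; exists H; rewrite prHG.
  by apply/existsP; exists k.
have [fful | nfful] := boolP (cfaithful 'chi_i); last first.
  pose K := cfker_group 'chi_i; have nsKG : (K <| G)%g := cfker_normal _.
  apply: (feit_witness_mod nsKG (subxx _) sylP).
  have DK : 'chi_(quo_Iirr K i) = ('chi_i / K)%CF by rewrite quo_IirrE.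
  have [|||||y wy] := IHm _ (G / K)%G (P / K)%G (quo_Iirr K i).
  - rewrite -ltnS; apply: leq_trans leGm; rewrite ltnS ltn_quotient ?cfker_sub //.
    by apply: contra nfful; rewrite /cfaithful => /eqP ->.
  - exact: quotient_sol.
  - by apply: quotient_pHall => //; rewrite (subset_trans (pHall_sub sylP)) ?normal_norm.
  - by move=> d; rewrite DK cfQuo1 => /p'chi.
  - by move=> d; rewrite DK cfQuo1 => /odd_chi.
  by exists y; rewrite -DK.
have [abG | nabG] := boolP (abelian G).
  have cycG : cyclic G by rewrite -(center_idP abG) (irr_faithful_center fful).
  have [x DG] := cyclicP cycG; exists x; have sPG := pHall_sub sylP.
  have Gx : x \in G by rewrite DG cycle_id.
  have abP := abelianS sPG abG.
  split; first by rewrite inE Gx (subsetP (sub_abelian_norm abG sPG)).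
  move=> k; rewrite (derG1P abP) => /set1P xk1 u fix_u.
  apply/cfun_inP=> y Gy; have /cycleP[l ->] : y \in <[x]>%g by rewrite -DG.
  rewrite cfunE.
  have lin := irr_cyclic_lin i cycG.
  by rewrite fix_u // -lin_charX ?groupX // -expgM mulnC expgM xk1 expg1n lin_char1.
have [H [k [n [prHG iGH chi1 fix_k]]]] := primitive_reduction solG nabG fful prim odd_chi.
apply: (reduce H k) => //; last by exists n.
have [d Dd] := natrP (Cnat_irr1 k).
have := p'chi (d * n)%N; rewrite chi1 Dd natrM => /(_ erefl).
by rewrite Euclid_dvdM // negb_or iGH Euclid_dvdX // negb_and => /andP[_ ->].
Qed.

(** * Character fields and cyclotomic fields *)

Section CyclotomicFields.

Implicit Types (u v : {rmorphism algC -> algC}) (m n : nat).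

Definition fixes_roots n u := forall z, z ^+ n = 1 -> u z = z.

(** The values on which two automorphisms agree form a field. *)
Lemma cfAut_eq_cyclotomic (gT : finGroupType) (G : {group gT}) (chi : 'CF(G)) n u v :
    (0 < n)%N -> {subset cf_field chi <= Q_cyclotomic n} ->
  (forall z, z ^+ n = 1 -> u z = v z) -> cfAut u chi = cfAut v chi.
Proof.
move=> n_gt0 Qn_chi eq_uv; apply/cfun_inP=> x Gx; rewrite !cfunE /=.
have /Qn_chi/Q_adjoinP : chi x \in cf_field chi by apply/sub_Q_adjoin/image_f.
move/(_ [pred y | u y == v y])=> /= Huv; apply/eqP; apply: Huv.
  split=> [|y z|y z]; rewrite !inE ?rmorph1 // => /eqP Ey /eqP Ez.
    by rewrite !rmorphB /= Ey Ez.
  by rewrite !fmorph_div /= Ey Ez.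
move=> z; rewrite inE => /eqP->; rewrite inE; apply/eqP/eq_uv.
case: (C_prim_root_exists _) => z0 /= /prim_expr_order.
by rewrite prednK.
Qed.

(** Let u raise the roots of unity of order dividing mn to the power k, so that
    k is 1 modulo gcd(m, n). By the Chinese remainder theorem some automorphism
    v fixes the m-th roots of unity and agrees with u on the n-th ones. Then u
    and v agree on Q_n, and v fixes Q_m. *)
Lemma cfAut_fix_gcd (gT : finGroupType) (G : {group gT}) (chi : 'CF(G)) m n u :
    (0 < m)%N -> (0 < n)%N ->
    {subset cf_field chi <= Q_cyclotomic m} ->
    {subset cf_field chi <= Q_cyclotomic n} ->
  fixes_roots (gcdn m n) u -> cfAut u chi = chi.
Proof.
move=> m_gt0 n_gt0 Qm Qn fix_u; set g := gcdn m n in fix_u.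
have N_gt0 : (0 < m * n)%N by rewrite muln_gt0 m_gt0.
have g_gt0 : (0 < g)%N by rewrite gcdn_gt0 m_gt0.
have [w pr_w] := C_prim_root_exists N_gt0.
have [k0 Dk0] : exists k0, u w = w ^+ k0.
  have [|k0 ->] := prim_rootP pr_w (x := u w); last by exists k0.
  by rewrite -rmorphXn /= (prim_expr_order pr_w) rmorph1.
(* Adding mn to the exponent changes nothing and makes k.-1 meaningful. *)
pose k := (k0 + m * n)%N.
have uE z : z ^+ (m * n) = 1 -> u z = z ^+ k.
  case/(prim_rootP pr_w)=> j ->; rewrite rmorphXn /= Dk0 /k.
  by rewrite exprD (exprAC w j (m * n)) (prim_expr_order pr_w) expr1n mulr1 exprAC.
have co_k : coprime k (m * n).
  rewrite -(prim_root_exp_coprime _ pr_w) -uE ?(prim_expr_order pr_w) //.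
  by rewrite fmorph_primitive_root.
have k_gt0 : (0 < k)%N by rewrite addn_gt0 N_gt0 orbT.
have g_k : (g %| k.-1)%N.
  have gN : (g %| m * n)%N by rewrite dvdn_mulr ?dvdn_gcdl.
  have pr_wg := dvdn_prim_root pr_w gN.
  have := uE _ (expr_dvd (prim_expr_order pr_wg) gN).
  rewrite (fix_u _ (prim_expr_order pr_wg)) -{1}[_ ^+ _]expr1 => /eqP.
  by rewrite eq_sym (eq_prim_root_expr pr_wg) eqn_mod_dvd // subn1.
(* The exponent of v: 1 modulo m and k modulo n. *)
have [t Dt] : exists t, (m * t).+1 = k %[mod n].
  have [a _ /dvdnP[c Dc]] := Bezoutl m n_gt0; have /dvdnP[q Dq] := g_k.
  exists (a * q * n.-1)%N.
  suffices E : (m * (a * q * n.-1) = q * g %[mod n])%N.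
    by rewrite -(prednK k_gt0) Dq -addn1 -modnDml E modnDml addn1.
  rewrite -(modnMDl (q * g) (m * _)).
  rewrite gcdnC -/g in Dc.
  have -> : (q * g * n + m * (a * q * n.-1) = q * n.-1 * (g + a * m) + q * g)%N.
    by rewrite -{1}(prednK n_gt0); lia.
  by rewrite Dc mulnA modnMDl.
have [v Dv] : {v : {rmorphism algC -> algC}
                | forall z, z ^+ (m * n) = 1 -> v z = z ^+ (m * t).+1}.
  apply: Qn_aut_exists; rewrite coprimeMr; apply/andP; split.
    by rewrite -addn1 coprime_sym /coprime mulnC gcdnMDl gcdn1.
  rewrite -coprime_modl Dt coprime_modl.
  by move: co_k; rewrite coprimeMr => /andP[].
transitivity (cfAut v chi).
  apply: (cfAut_eq_cyclotomic n_gt0 Qn) => z zn1.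
  have zN1 : z ^+ (m * n) = 1 by apply: expr_dvd zn1 _; apply: dvdn_mull.
  rewrite (uE _ zN1) (Dv _ zN1).
  by rewrite -(expr_mod _ zn1) -[RHS](expr_mod _ zn1) Dt.
transitivity (cfAut idfun chi); last by apply/cfunP=> x; rewrite cfunE.
apply: (cfAut_eq_cyclotomic m_gt0 Qm) => z zm1 /=.
have zN1 : z ^+ (m * n) = 1 by apply: expr_dvd zm1 _; apply: dvdn_mulr.
by rewrite (Dv _ zN1) exprS exprM zm1 expr1n mulr1.
Qed.

(** The divisibility of |G| by n places the n-th roots of unity in the Galois
    number field that contains the values of chi, where the fixed field of the
    automorphisms fixing them is Q_n. *)
Lemma cyclotomic_of_cfAut_fix (gT : finGroupType) (G : {group gT}) (chi : 'CF(G)) n :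
    chi \is a character -> (n %| #|G|)%N ->
    (forall u, fixes_roots n u -> cfAut u chi = chi) ->
  {subset cf_field chi <= Q_cyclotomic n}.
Proof.
move=> Nchi dv_n_G fix_chi.
have n_gt0 : (0 < n)%N := dvdn_gt0 (cardG_gt0 G) dv_n_G.
apply/Q_adjoin_subset/allP=> _ /imageP[x Gx ->].
have [Qn galQn [QnC autQn [w [pr_w _] valQn]]] := group_num_field_exists G.
have [a Da] := valQn _ _ _ Nchi x (order_dvdG Gx).
pose wn := w ^+ (#|G| %/ n).
have pr_wn : n.-primitive_root wn := dvdn_prim_root pr_w dv_n_G.
have galK : galois <<1; wn>> {:Qn} by apply: galoisS galQn; rewrite sub1v subvf.
have Ka : a \in <<1 & [:: wn]>>%VS.
  rewrite adjoin_seq1 -(galois_fixedField galK); apply/fixedFieldP; rewrite ?memvf //.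
  move=> nu Gnu; have [u Du] := autQn nu.
  apply: (fmorph_inj QnC); rewrite Du Da.
  rewrite -[LHS](cfunE _ _ : cfAut u chi x = _).
  rewrite fix_chi // => z.
  case/(prim_rootP (_ : n.-primitive_root (QnC wn))) => [|j ->].
    by rewrite fmorph_primitive_root.
  rewrite rmorphXn /= -Du (fixed_gal _ Gnu) ?memv_adjoin //.
  exact: subvf.
apply/Q_adjoinP=> S divS sS; rewrite -Da; apply: (mem_num_field_adjoin divS) Ka.
move=> _ /[!inE]/eqP->.
pose B := GRing.isDivringClosed.Build algC S divS.
pose S' : divringClosed algC := HB.pack S B.
have: sval (C_prim_root_exists (ltn0Sn n.-1)) \in S' by apply: sS; rewrite mem_head.
case: (C_prim_root_exists _) => z0 /=; rewrite {1}prednK // => pr_z0 Sz0.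
have [|j ->] := prim_rootP pr_z0 (x := QnC wn).
  by rewrite -rmorphXn /= (prim_expr_order pr_wn) rmorph1.
exact: (rpredX (S := S')).
Qed.

End CyclotomicFields.

Theorem theoremA (gT : finGroupType) (G P : {group gT}) (p : nat) (i : Iirr G)
    (p_pr : prime p) (solG : solvable G)
    (p'chi : ~~ (p %| 'chi_i 1%g)%C) (sylP : P \in ('Syl_p(G))%g)
    (odd_chi : ~~ (2%N %| 'chi_i 1%g)%C) :
  (exists2 g, g \in ('N_G(P) / P^`(1))%g & #[g]%g = feit_number i)
  /\ (feit_number i %| #|'N_G(P) : P^`(1)|%g)%N.
Proof.
have [f_gt0 Qf min_f] := feit_numberP i; set f := feit_number i in f_gt0 Qf min_f *.
have sylP' : (p.-Sylow(G) P)%g by rewrite inE in sylP.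
have [x [Nx fix_x]] : exists x, feit_witness P 'chi_i x.
  apply: (feit_witness_exists p_pr solG sylP') => d Dd.
    by move: p'chi; rewrite Dd dvdC_nat.
  by move: odd_chi; rewrite Dd dvdC_nat dvdn2 negbK.
have nP'N : 'N_G(P)%g \subset 'N(P^`(1))%g.
  exact: subset_trans (subsetIr _ _) (char_norms (der_char 1 P)).
pose y := coset P^`(1)%g x; have Ny : y \in ('N_G(P) / P^`(1))%g by apply: mem_quotient.
have dv_y : (#[y]%g %| #|'N_G(P) : P^`(1)|%g)%N by rewrite -card_quotient ?order_dvdG.
have dv_yG : (#[y]%g %| #|G|)%N.
  apply: dvdn_trans dv_y (dvdn_trans (dvdn_indexg _ _) (cardSg (subsetIl _ _))).
have fix_y u : fixes_roots #[y]%g u -> cfAut u 'chi_i = 'chi_i.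
  apply: fix_x; have nP'x := subsetP nP'N _ Nx.
  by apply: coset_idr; rewrite ?groupX // morphX ?expg_order.
have Qy := cyclotomic_of_cfAut_fix (irr_char i) dv_yG fix_y.
have f_y : (f %| #[y]%g)%N.
  have Qgcd : {subset cf_field 'chi_i <= Q_cyclotomic (gcdn f #[y]%g)}.
    apply: (cyclotomic_of_cfAut_fix (irr_char i)).
      exact: dvdn_trans (dvdn_gcdr _ _) dv_yG.
    by move=> u; apply: cfAut_fix_gcd.
  have le_f : (f <= gcdn f #[y]%g)%N by apply: min_f; rewrite // gcdn_gt0 f_gt0.
  have -> : f = gcdn f #[y]%g.
    by apply/eqP; rewrite eqn_leq le_f dvdn_leq ?dvdn_gcdl.
  exact: dvdn_gcdr.
split; last exact: dvdn_trans f_y dv_y.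
have [c Dc] := dvdnP f_y; exists (y ^+ c)%g; first exact: groupX.
rewrite orderXdiv Dc ?dvdn_mulr // mulKn //.
by move: (order_gt0 y); rewrite Dc muln_gt0 => /andP[].
Qed.
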